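(* Let $\{\alpha_i \mid -1\le i\le r\}$ be the simple roots of a Lorentzian Kac-Moody algebra $\mathcal{A}$ (of rank $r+2$), so $\alpha_1,\dots,\alpha_r$ are the simple roots of a finite dimensional simple Lie algebra, $\alpha_0$ is the affine simple root which generates an affine root system when included in the list, and $\alpha_{-1}$ satisfies $(\alpha_{-1},\alpha_{-1})=2$, $(\alpha_{-1},\alpha_0)=-1$, $(\alpha_{-1},\alpha_i)=0$ for $1\le i\le r$. Write the affine null root $\delta=\sum_{j=0}^r n_j\alpha_j$ where $n_0=1$. Fix any integer $m\ge 0$ and define $$\beta_0=\alpha_{-1},\qquad \beta_1=\beta_1^{(m)}=m\delta+\alpha_1,\qquad \beta_j=\alpha_j\ \text{ for } 2\le j\le r.$$ Then the Kac-Moody Lie subalgebra $\mathcal{A}(\beta_0,\dots,\beta_r)$ of $\mathcal{A}$, generated by nonzero root vectors $E_i\in\mathcal{A}_{\beta_i}$, $F_i\in\mathcal{A}_{-\beta_i}$ and $H_i=[E_i,F_i]$, $0\le i\le r$, has Cartan matrix $$C=[(\beta_i,\beta_j^\vee)]=\begin{bmatrix}2&-m&0&\cdots&0\\-m&2&*&\cdots&*\\0&*&2&\cdots&*\\ \vdots&&&&\\0&*&*&\cdots&2\end{bmatrix}$$ which is rank $r+1$ of indefinite type for $m\ge 2$, where the submatrix obtained by removing the first row and column of $C$ is the finite type Cartan matrix $C_r^{fin}$ determined by $\alpha_1,\dots,\alpha_r$. This subalgebra is also denoted by $\mathcal{A}_{r+1}^{indef}(m)$.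
   Context: A Lorentzian Kac-Moody algebra here is one obtained from an affine algebra by the procedure of over-extension: an additional node (corresponding to $\alpha_{-1}$) is attached by one line only to the affine node (corresponding to $\alpha_0$) in an affine Dynkin diagram. $(\cdot,\cdot)$ is the invariant symmetric bilinear form on the dual of the Cartan subalgebra, normalized as in the claim. For a root $\alpha$ with $(\alpha,\alpha)\ne0$, $\alpha^\vee=2\alpha/(\alpha,\alpha)$; the Cartan matrix of $\mathcal{A}$ has entries $(\alpha_i,\alpha_j^\vee)$. $\mathcal{A}_\beta$ denotes the root space of $\mathcal{A}$ for the root $\beta$. That the subalgebra is a Kac-Moody algebra with Cartan matrix $C=[C_{ij}]$ means that (with the $F_i$ scaled so that $\beta_i(H_i)=2$) its generators $E_i,F_i,H_i$ satisfy the Serre relations determined by $C$: $[H_i,H_j]=0$, $[H_i,E_j]=C_{ji}E_j$, $[H_i,F_j]=-C_{ji}F_j$, $[E_i,F_j]=\delta_{ij}H_i$, and $(\mathrm{ad}\,E_i)^{1-C_{ji}}E_j=0=(\mathrm{ad}\,F_i)^{1-C_{ji}}F_j$ for $i\neq j$. Indefinite type means neither of finite nor of affine type.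
   Formalization: For m>0 the formal version assumes (α_1,α_1)=2, since otherwise the displayed entry -m is wrong (short α_1 of G_2 gives -3m), and it excludes r=1, m=2 from the rank and indefinite-type claim, where C=[[2,-2],[-2,2]] is affine of rank 1. *)

(* Defs.v *)
From HB Require Import structures.
From mathcomp Require Import all_boot all_order all_algebra sesquilinear.

Set Implicit Arguments.
Unset Strict Implicit.
Unset Printing Implicit Defensive.

Import Order.TTheory GRing.Theory Num.Theory.
Local Open Scope ring_scope.

HB.mixin Record isLieAlgebra (K : pzRingType) L of GRing.Lmodule K L := {
  bracket : L -> L -> L;
  bracket_linearl : forall y, linear (fun x => bracket x y);
  bracket_linearr : forall x, linear (bracket x);
  bracketxx : forall x, bracket x x = 0;
  bracket_jacobi : forall x y z,
    bracket x (bracket y z) + bracket y (bracket z x)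
      + bracket z (bracket x y) = 0
}.

#[short(type="lieAlgType")]
HB.structure Definition LieAlgebra (K : pzRingType) :=
  { L of GRing.Lmodule K L & isLieAlgebra K L }.

(** * Generalized Cartan matrices

    Convention: A i j = (alpha_i, alpha_j^vee).  This is the transpose of Kac's
    convention, so that his column vectors become row vectors: the row vector u
    stands for \sum_i u_i alpha_i, and (u *m A)_j is its pairing with
    alpha_j^vee. *)

Definition gcm n (A : 'M[int]_n) : Prop :=
  [/\ forall i, A i i = 2,
      forall i j, i != j -> A i j <= 0
    & forall i j, A i j = 0 -> A j i = 0].

Definition indecomposable n (A : 'M[int]_n) : Prop :=
  forall S : {set 'I_n}, S != set0 -> S != setT ->
  exists i j, [/\ i \in S, j \notin S & A i j != 0].

Definition pos_row n (u : 'rV[rat]_n) : Prop := forall j, 0 < u 0 j.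
Definition nneg_row n (u : 'rV[rat]_n) : Prop := forall j, 0 <= u 0 j.

Definition ratmx n (A : 'M[int]_n) : 'M[rat]_n := map_mx intr A.

(** The trichotomy of Kac, Infinite dimensional Lie algebras, Theorem 4.3.  The
    matrix being integral, rational vectors serve as well as real ones. *)
Definition finite_type n (A : 'M[int]_n) : Prop :=
  [/\ gcm A, indecomposable A, \rank (ratmx A) = n,
      exists u, pos_row u /\ pos_row (u *m ratmx A)
    & forall v, nneg_row (v *m ratmx A) -> pos_row v \/ v = 0].

Definition affine_type n (A : 'M[int]_n) : Prop :=
  [/\ gcm A, indecomposable A, (\rank (ratmx A)).+1 = n,
      exists u, pos_row u /\ u *m ratmx A = 0
    & forall v, nneg_row (v *m ratmx A) -> v *m ratmx A = 0].

Definition indefinite_type n (A : 'M[int]_n) : Prop :=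
  [/\ gcm A, indecomposable A, ~ finite_type A & ~ affine_type A].

Definition drop_first n (A : 'M[int]_n.+1) : 'M[int]_n :=
  row' ord0 (col' ord0 A).

(** Index ord0 is the node of alpha_{-1}; index lift ord0 j is the node of
    alpha_j for j = 0, ..., r. *)
Definition over_extended r (A : 'M[int]_r.+2) : Prop :=
  [/\ gcm A,
      affine_type (drop_first A),
      finite_type (drop_first (drop_first A)),
      A ord0 (lift ord0 ord0) = -1 /\ A (lift ord0 ord0) ord0 = -1
    & forall j : 'I_r.+1, j != ord0 ->
        A ord0 (lift ord0 j) = 0 /\ A (lift ord0 j) ord0 = 0].

(** * Kac-Moody algebras *)

Section KacMoody.
Variable K : fieldType.

Definition serre_relations (L : lieAlgType K) n (C : 'M[int]_n)
    (E F H : 'I_n -> L) : Prop :=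
  [/\ forall i j, bracket (H i) (H j) = 0,
      forall i j, bracket (H i) (E j) = E j *~ C j i,
      forall i j, bracket (H i) (F j) = - (F j *~ C j i),
      forall i j, bracket (E i) (F j) = if i == j then H i else 0
    & forall i j, i != j ->
        iter `|1 - C j i|%N (bracket (E i)) (E j) = 0 /\
        iter `|1 - C j i|%N (bracket (F i)) (F j) = 0].

Inductive lie_span (L : lieAlgType K) (X : L -> Prop) : L -> Prop :=
| lie_span_gen x : X x -> lie_span X x
| lie_span0 : lie_span X 0
| lie_spanD x y : lie_span X x -> lie_span X y -> lie_span X (x + y)
| lie_spanZ (a : K) x : lie_span X x -> lie_span X (a *: x)
| lie_spanB x y : lie_span X x -> lie_span X y -> lie_span X (bracket x y).

Definition subalg_gen (L : lieAlgType K) n (E F H : 'I_n -> L) : L -> Prop :=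
  lie_span (fun x => exists i, [\/ x = E i, x = F i | x = H i]).

(** The subalgebra S of L is a Kac-Moody algebra with Cartan matrix C and
    Chevalley generators E, F, H. *)
Definition kac_moody_subalg (L : lieAlgType K) (S : L -> Prop) n
    (C : 'M[int]_n) (E F H : 'I_n -> L) : Prop :=
  (forall x, S x <-> subalg_gen E F H x) /\ serre_relations C E F H.

(** L is the Lie algebra presented by the Chevalley generators e, f, h and the
    Serre relations of A.  This is the whole Kac-Moody algebra when A is
    nonsingular (as every over-extended matrix is): the Cartan subalgebra then
    has basis h, and its dual has basis the simple roots. *)
Definition kac_moody_algebra (L : lieAlgType K) n (A : 'M[int]_n)
    (e f h : 'I_n -> L) : Prop :=
  [/\ forall x, subalg_gen e f h x,
      serre_relations A e f h
    & forall (M : lieAlgType K) (e' f' h' : 'I_n -> M),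
        serre_relations A e' f' h' ->
        exists phi : {linear L -> M},
          (forall x y, phi (bracket x y) = bracket (phi x) (phi y)) /\
          (forall i, [/\ phi (e i) = e' i, phi (f i) = f' i
                       & phi (h i) = h' i])].

(** * Roots

    Elements of the dual of the Cartan subalgebra are row vectors of coordinates
    in the basis of simple roots. *)

Definition alpha n (i : 'I_n) : 'rV[K]_n := delta_mx 0 i.

(** lambda(h_i), computed from alpha_j(h_i) = A j i. *)
Definition eval_h n (A : 'M[int]_n) (lambda : 'rV[K]_n) (i : 'I_n) : K :=
  (lambda *m map_mx intr A) 0 i.

Definition root_space (L : lieAlgType K) n (A : 'M[int]_n) (h : 'I_n -> L)
    (beta : 'rV[K]_n) (x : L) : Prop :=
  forall i, bracket (h i) x = eval_h A beta i *: x.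

Definition coroot n (form : {symmetric 'rV[K]_n}) (beta : 'rV[K]_n) :
    'rV[K]_n :=
  (2 / form beta beta) *: beta.

(** The invariant form on the dual of the Cartan subalgebra; for indecomposable
    A this determines the form up to a nonzero scalar. *)
Definition invariant_form n (A : 'M[int]_n) (form : {symmetric 'rV[K]_n}) :
    Prop :=
  forall i j, form (alpha i) (coroot form (alpha j)) = (A i j)%:~R.

Definition alpha_m1 r : 'rV[K]_r.+2 := alpha ord0.
Definition alpha_aff r (j : 'I_r.+1) : 'rV[K]_r.+2 := alpha (lift ord0 j).

(** The coefficients n_0, ..., n_r of the null root; n_0 = 1 makes them
    coprime. *)
Definition null_root_marks r (A : 'M[int]_r.+2) (marks : 'rV[int]_r.+1) :
    Prop :=
  [/\ forall j, 0 < marks 0 j, marks *m drop_first A = 0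
    & marks 0 ord0 = 1].

Definition null_root r (marks : 'rV[int]_r.+1) : 'rV[K]_r.+2 :=
  \sum_(j < r.+1) (marks 0 j)%:~R *: alpha_aff j.

Definition beta r (marks : 'rV[int]_r.+1) (m : nat) (j : 'I_r.+1) :
    'rV[K]_r.+2 :=
  if j == 0%N :> nat then alpha_m1 r
  else if j == 1%N :> nat then m%:R *: null_root marks + alpha_aff j
  else alpha_aff j.

End KacMoody.

(** First row and first column (2, -m, 0, ..., 0) of the matrix C. *)
Definition border (m j : nat) : int :=
  if j == 0%N then 2 else if j == 1%N then - m%:Z else 0.

(* Main.v *)
Require Import Defs.
From HB Require Import structures.
From mathcomp Require Import all_boot all_order all_algebra sesquilinear.
From mathcomp Require Import zify ring lra.

(** The presented algebra is spanned by the words in the [e i], the words in the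
    [f i], and the [h i]. As [A] is nonsingular ([over_extended_inj]), the
    eigenvalues of the [h i] separate weights, so the words of a given weight span
    its weight space ([weight_graded]). Hence the coordinates of a root have one
    sign, the simple root spaces are lines, and no other positive multiple of a
    simple root is a root.

    The Chevalley generators act locally nilpotently, and their exponentials lift
    the simple reflections to embeddings of the algebra into itself
    ([simple_reflection]). A positive root of positive norm descends
    to a simple root under such reflections ([positive_norm_real]). Along the
    descent one learns that opposite root vectors bracket, up to a nonzero scalar,
    to an element acting as the coroot, that they are locally nilpotent
    ([real_root_coroot]), and that the coroot is an integral combination of simple
    coroots.

    The null root [delta] is isotropic and orthogonal to [alpha_0, ..., alpha_r],
    and it pairs to [-1] with [alpha_{-1}]. So the roots [beta_j] have the norms of
    simple roots, which are positive: the diagram is connected, and neighbouring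
    norms have positive rational ratios. This gives the matrix [C] and the action
    of the [H i]. It remains to see that [beta_i - beta_j] is never a root. Its
    coordinates have both signs, unless it is, up to sign,
    [m delta + alpha_1 - alpha_j]; this has positive norm, but its coroot is not
    integral ([int_beta_sub_not_integral]). The relations between the [E i] alone,
    or the [F i] alone, then follow from the representation theory of sl2
    ([lowest_weight_bound]). Whether [m delta + alpha_1] is a root depends on [A]
    and [m]; it is one as soon as a nonzero root vector is given.

    For the type of [C], let [u] be the row of [alpha_1] in the inverse of the
    finite Cartan matrix. It is positive, and [2 u_1 >= 1] with equality only for
    [r = 1]. Therefore [m^2 u_1 > 2], which makes [C] nonsingular, so not of affine
    type, and makes the image of [- (1/m, u)] under [C] nonnegative, so that [C] is
    not of finite type ([bordered_indefinite]). *)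

Set Implicit Arguments.
Unset Strict Implicit.
Unset Printing Implicit Defensive.

Import Order.TTheory GRing.Theory Num.Theory.
Local Open Scope ring_scope.

(** * Locally nilpotent derivations and their exponentials *)

Section LieAlgebra.
Variables (K : fieldType) (L : lieAlgType K).
Implicit Types (x y z u : L) (a : K).

HB.instance Definition _ x :=
  GRing.isLinear.Build K L L *:%R (bracket x) (bracket_linearr x).

Lemma bracketDl x y z : bracket (x + y) z = bracket x z + bracket y z.
Proof. by have := bracket_linearl z 1 x y; rewrite /= !scale1r. Qed.

Lemma bracket0l z : bracket 0 z = 0 :> L.
Proof. by apply: (addrI (bracket 0 z)); rewrite -bracketDl !addr0. Qed.

Lemma bracketZl a x z : bracket (a *: x) z = a *: bracket x z.
Proof. by have := bracket_linearl z a x 0; rewrite /= bracketDl bracket0l !addr0. Qed.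

Lemma bracketNl x z : bracket (- x) z = - bracket x z.
Proof. by rewrite -scaleN1r bracketZl scaleN1r. Qed.

Lemma bracketC x y : bracket x y = - bracket y x.
Proof.
apply/eqP; rewrite -addr_eq0; apply/eqP.
by have := bracketxx (x + y); rewrite bracketDl !raddfD /= !bracketxx add0r addr0.
Qed.

Lemma bracket_suml (I : Type) (s : seq I) (P : pred I) (F : I -> L) z :
  bracket (\sum_(i <- s | P i) F i) z = \sum_(i <- s | P i) bracket (F i) z.
Proof.
by apply: (big_morph (fun x => bracket x z)) => [x y|]; rewrite ?bracketDl ?bracket0l.
Qed.

(** The Jacobi identity, read as: [ad x] is a derivation. *)
Lemma bracket_deriv x y z :
  bracket x (bracket y z) = bracket (bracket x y) z + bracket y (bracket x z).
Proof.
have := bracket_jacobi x y z.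
rewrite (bracketC z (bracket x y)) (bracketC z x) raddfN /= -addrA -opprD => /eqP.
by rewrite subr_eq0 => /eqP ->; rewrite addrC.
Qed.

Lemma bracketDr x y z : bracket z (x + y) = bracket z x + bracket z y.
Proof. exact: raddfD. Qed.

Lemma bracketNr x z : bracket z (- x) = - bracket z x.
Proof. exact: raddfN. Qed.

Lemma bracket0r z : bracket z 0 = 0 :> L.
Proof. exact: raddf0. Qed.

Lemma bracketZr a x z : bracket z (a *: x) = a *: bracket z x.
Proof. exact: linearZ. Qed.

Lemma bracketMzr x (k : int) z : bracket z (x *~ k) = bracket z x *~ k.
Proof. by rewrite -!scaler_int bracketZr. Qed.

Lemma bracketMnr x (k : nat) z : bracket z (x *+ k) = bracket z x *+ k.
Proof. exact: raddfMn. Qed.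

Lemma bracketMzl x (k : int) z : bracket (x *~ k) z = bracket x z *~ k.
Proof. by rewrite -!scaler_int bracketZl. Qed.

(** The equation is boolean so that [ex_minn] can extract the exponent. *)
Definition ad_nilpotent u := forall x, exists N, iter N (bracket u) x == 0.

Lemma iter_bracket_le u x M N : (M <= N)%N ->
  iter M (bracket u) x = 0 -> iter N (bracket u) x = 0.
Proof.
move=> /subnK <- H; rewrite iterD H.
by elim: (N - M)%N => //= k ->; rewrite raddf0.
Qed.

Lemma iter_bracketD u N x y :
  iter N (bracket u) (x + y) = iter N (bracket u) x + iter N (bracket u) y.
Proof. by elim: N => //= N ->; rewrite raddfD. Qed.

Lemma iter_bracketZ u N a x :
  iter N (bracket u) (a *: x) = a *: iter N (bracket u) x.
Proof. by elim: N => //= N ->; rewrite linearZ. Qed.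

Lemma iter_bracket_sum u N (I : Type) (s : seq I) (P : pred I) (F : I -> L) :
  iter N (bracket u) (\sum_(i <- s | P i) F i)
  = \sum_(i <- s | P i) iter N (bracket u) (F i).
Proof.
apply: (big_morph (iter N (bracket u))) => [x y|]; first exact: iter_bracketD.
by elim: N => //= N ->; rewrite raddf0.
Qed.

Lemma iter_bracket_scale u a N x :
  iter N (bracket (a *: u)) x = a ^+ N *: iter N (bracket u) x.
Proof.
elim: N => [|N IH] /=; first by rewrite scale1r.
by rewrite IH bracketZl linearZ scalerA exprS.
Qed.

Lemma ad_nilpotentZ a u : ad_nilpotent u -> ad_nilpotent (a *: u).
Proof.
by move=> nu z; have [N /eqP HN] := nu z; exists N; rewrite iter_bracket_scale HN scaler0.
Qed.

Lemma iter_bracket_Leibniz u N x y :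
  iter N (bracket u) (bracket x y)
  = \sum_(i < N.+1) bracket (iter i (bracket u) x) (iter (N - i) (bracket u) y) *+ 'C(N, i).
Proof.
elim: N => [|N IH]; first by rewrite big_ord_recl big_ord0 addr0 bin0 mulr1n.
rewrite iterS IH raddf_sum /=.
under eq_bigr => i _ do rewrite raddfMn /= bracket_deriv mulrnDl -!iterS.
rewrite big_split /= [RHS]big_ord_recl bin0 subn0 /=.
under [in RHS]eq_bigr => i _ do rewrite /bump /= add1n binS mulrnDr subSS.
rewrite big_split /= addrA [RHS]addrC; congr (_ + _).
rewrite big_ord_recl /= subn0 bin0; congr (_ + _).
rewrite [RHS]big_ord_recr /= (@bin_small N N.+1) // mulr0n addr0.
apply: eq_bigr => i _; rewrite /bump /= add1n; congr (bracket _ _ *+ _).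
by rewrite -iterS -subSn ?subSS.
Qed.

Lemma ad_nilpotent_bracket u x y N M :
  iter N (bracket u) x = 0 -> iter M (bracket u) y = 0 ->
  iter (N + M) (bracket u) (bracket x y) = 0.
Proof.
move=> Hx Hy; rewrite iter_bracket_Leibniz big1 // => i _.
case: (leqP N i) => [le|lt]; first by rewrite (iter_bracket_le le Hx) bracket0l mul0rn.
rewrite (@iter_bracket_le u y M (N + M - i)%N _ Hy) ?raddf0 ?mul0rn //.
by rewrite -addnBAC ?leq_addl // ltnW.
Qed.

Hypothesis charK : [pchar K] =i pred0.

Section Exp.
Variables (u : L) (nilp : ad_nilpotent u).

Definition exp_ad x :=
  \sum_(k < ex_minn (nilp x)) (k`!%:R : K)^-1 *: iter k (bracket u) x.

Lemma exp_adE N x : iter N (bracket u) x = 0 ->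
  exp_ad x = \sum_(k < N) (k`!%:R : K)^-1 *: iter k (bracket u) x.
Proof.
rewrite /exp_ad; case: ex_minnP => M /eqP HM Hmin HN.
have leMN : (M <= N)%N by apply: Hmin; apply/eqP.
rewrite -(subnKC leMN) big_split_ord /= [X in _ + X]big1 ?addr0 // => i _.
by rewrite (iter_bracket_le (leq_addr i M) HM) scaler0.
Qed.

Lemma exp_ad_linear : linear exp_ad.
Proof.
move=> a x y.
have /eqP Hx := xchooseP (nilp x); have /eqP Hy := xchooseP (nilp y).
set N := xchoose _ in Hx; set M := xchoose _ in Hy.
have {}Hx := iter_bracket_le (leq_addr M N) Hx.
have {}Hy := iter_bracket_le (leq_addl N M) Hy.
rewrite (exp_adE Hx) (exp_adE Hy) (@exp_adE (N + M)); last first.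
  by rewrite iter_bracketD iter_bracketZ Hx Hy scaler0 addr0.
rewrite scaler_sumr -big_split /=; apply: eq_bigr => i _.
by rewrite iter_bracketD iter_bracketZ scalerDr !scalerA mulrC.
Qed.

(** The reindexing of a Cauchy product by total degree. *)
Lemma sum_antidiagonal (V : zmodType) (F : nat -> nat -> V) P :
  \sum_(n < P) \sum_(i < n.+1) F i (n - i)%N
  = \sum_(i < P) \sum_(j < P - i) F i j.
Proof.
elim: P => [|P IH]; first by rewrite !big_ord0.
rewrite big_ord_recr /= IH [in LHS](big_ord_recr P (fun i : 'I_P.+1 => F i (P - i)%N)) /=.
rewrite addrA -big_split /= [RHS]big_ord_recr /= subSnn big_ord_recl big_ord0 addr0 subnn.
congr (_ + _); apply: eq_bigr => i _.
by rewrite subSn 1?ltnW // big_ord_recr.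
Qed.

Lemma sum_ord_trim (V : zmodType) (G : nat -> V) P Q : (Q <= P)%N ->
  (forall j, (Q <= j)%N -> G j = 0) -> \sum_(j < P) G j = \sum_(j < Q) G j.
Proof.
move=> /subnKC <- HG; rewrite big_split_ord /= [X in _ + X]big1 ?addr0 // => j _.
by rewrite HG ?leq_addr.
Qed.

Lemma fact_neq0 k : (k`!%:R : K) != 0.
Proof. by rewrite (pcharf0P K).1 // -lt0n fact_gt0. Qed.

(** The exponential of a locally nilpotent derivation respects the bracket: in
    divided powers the Leibniz rule becomes the Cauchy product. *)
Lemma exp_ad_bracket x y : exp_ad (bracket x y) = bracket (exp_ad x) (exp_ad y).
Proof.
have /eqP Hx := xchooseP (nilp x); have /eqP Hy := xchooseP (nilp y).
set N := xchoose _ in Hx; set M := xchoose _ in Hy.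
have Hxy := ad_nilpotent_bracket Hx Hy.
have Hx' := iter_bracket_le (leq_addr M N) Hx.
have Hy' := iter_bracket_le (leq_addl N M) Hy.
rewrite (exp_adE Hx') (exp_adE Hy') (exp_adE Hxy) bracket_suml.
pose F i j := bracket ((i`!%:R : K)^-1 *: iter i (bracket u) x)
                      ((j`!%:R : K)^-1 *: iter j (bracket u) y).
transitivity (\sum_(n < N + M) \sum_(i < n.+1) F i (n - i)%N).
  apply: eq_bigr => n _; rewrite iter_bracket_Leibniz scaler_sumr.
  apply: eq_bigr => i _; rewrite /F bracketZl linearZ /= scalerA -scaler_nat scalerA.
  congr (_ *: _); have le_in : (i <= n)%N by rewrite -ltnS.
  have := fact_neq0 i; have := fact_neq0 (n - i); have := fact_neq0 n.
  rewrite -(bin_fact le_in) !natrM; move: ('C(_, _)%:R : K) => c.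
  move: (_`!%:R : K) => p; move: (_`!%:R : K) => q h1 h2 h3.
  by field; rewrite h2 h3; move: h1; rewrite !mulf_eq0 !negb_or => /andP[-> _].
rewrite sum_antidiagonal; apply: eq_bigr => i _; rewrite raddf_sum /= -/(F _ _).
symmetry; apply: (@sum_ord_trim _ (fun j => F i j)); first exact: leq_subr.
move=> j le_j; rewrite /F; have [leNi|ltiN] := leqP N i.
  by rewrite (iter_bracket_le leNi Hx) scaler0 bracket0l.
rewrite (@iter_bracket_le u y M _ _ Hy) ?scaler0 ?raddf0 //.
by apply: leq_trans le_j; rewrite -addnBAC ?leq_addl // ltnW.
Qed.

(** The last nonvanishing power of [bracket u] at [x] kills all the terms of
    [exp_ad x] except the first, which it does not kill. *)
Lemma exp_ad_inj x : exp_ad x = 0 -> x = 0.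
Proof.
move=> Hx; have := nilp x; case/ex_minnP => -[|N] /eqP HN Hmin //.
have /negP[] : iter N (bracket u) x != 0.
  by apply/negP => /Hmin; rewrite ltnn.
have := congr1 (iter N (bracket u)) Hx.
rewrite (exp_adE HN) iter_bracket_sum big_ord_recl /= big1 => [|i _].
  by rewrite addr0 fact0 invr1 scale1r => ->; elim: {HN Hmin} N => //= N /eqP ->; rewrite raddf0.
suff E : iter N (bracket u) (iter (bump 0 i) (bracket u) x) = 0.
  by rewrite (iter_bracketZ u N) E scaler0.
by rewrite -iterD; apply: iter_bracket_le HN; rewrite /bump /= add1n addnS ltnS leq_addr.
Qed.

End Exp.

End LieAlgebra.

(** * Lifting the simple reflections to the Lie algebra *)

Definition lie_embedding (K : fieldType) (L : lieAlgType K) (phi : L -> L) :=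
  [/\ linear phi, forall x y, phi (bracket x y) = bracket (phi x) (phi y)
    & forall x, phi x = 0 -> x = 0].

Section Embedding.
Variables (K : fieldType) (L : lieAlgType K) (phi : L -> L).
Hypothesis emb : lie_embedding phi.

Lemma lie_embeddingD x y : phi (x + y) = phi x + phi y.
Proof. by case: emb => lin _ _; have := lin 1 x y; rewrite !scale1r. Qed.

Lemma lie_embedding0 : phi 0 = 0.
Proof. by apply: (addrI (phi 0)); rewrite -lie_embeddingD !addr0. Qed.

Lemma lie_embeddingZ a x : phi (a *: x) = a *: phi x.
Proof. by case: emb => lin _ _; have := lin a x 0; rewrite lie_embedding0 !addr0. Qed.

Lemma lie_embeddingMz x k : phi (x *~ k) = phi x *~ k.
Proof. by rewrite -!scaler_int lie_embeddingZ. Qed.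

Lemma lie_embedding_inj : injective phi.
Proof.
case: (emb) => _ _ inj x y eq_xy; apply/eqP; rewrite -subr_eq0; apply/eqP/inj.
by rewrite lie_embeddingD -scaleN1r lie_embeddingZ eq_xy scaleN1r subrr.
Qed.

Lemma lie_embedding_iter N u x :
  phi (iter N (bracket u) x) = iter N (bracket (phi u)) (phi x).
Proof. by case: emb => _ br _; elim: N => //= N <-. Qed.

Lemma lie_embedding_nilp u : ad_nilpotent (phi u) -> ad_nilpotent u.
Proof.
move=> nilp x; have [N /eqP HN] := nilp (phi x); exists N.
by case: (emb) => _ _ inj; apply/eqP/inj; rewrite lie_embedding_iter.
Qed.

End Embedding.

Lemma lie_embedding_id (K : fieldType) (L : lieAlgType K) :
  lie_embedding (@idfun L).
Proof. by []. Qed.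

Lemma lie_embedding_comp (K : fieldType) (L : lieAlgType K) (phi psi : L -> L) :
  lie_embedding phi -> lie_embedding psi -> lie_embedding (phi \o psi).
Proof.
move=> [l1 b1 i1] [l2 b2 i2]; split=> [a x y|x y|x] /=; last by move=> /i1/i2.
  by rewrite (l2 a x y) (l1 a).
by rewrite b2 b1.
Qed.

Section Reflection.
Variables (K : fieldType) (charK : [pchar K] =i pred0) (L : lieAlgType K).

Lemma exp_ad_embedding u (nilp : ad_nilpotent u) : lie_embedding (exp_ad nilp : L -> L).
Proof.
split; [exact: exp_ad_linear|exact: exp_ad_bracket|exact: exp_ad_inj].
Qed.

Lemma exp_ad1 u (nilp : ad_nilpotent u) (x : L) :
  bracket u (bracket u x) = 0 -> exp_ad nilp x = x + bracket u x.
Proof.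
by move=> H; rewrite (@exp_adE _ _ _ _ 2) // !big_ord_recl big_ord0 /= !invr1 !scale1r addr0.
Qed.

Variables (e f t : L).
Hypotheses (ef : bracket e f = t) (te : bracket t e = e *+ 2)
  (tf : bracket t f = - (f *+ 2)).
Hypotheses (nilp_e : ad_nilpotent e) (nilp_Nf : ad_nilpotent (- f)).

(** In the group SL2, the product exp(e) exp(-f) exp(e) represents the nontrivial
    element of the Weyl group. *)
Definition lie_reflection x := exp_ad nilp_e (exp_ad nilp_Nf (exp_ad nilp_e x)).

Lemma lie_reflection_embedding : lie_embedding lie_reflection.
Proof.
have Ee := exp_ad_embedding nilp_e; have Ef := exp_ad_embedding nilp_Nf.
exact: lie_embedding_comp Ee (lie_embedding_comp Ef Ee).
Qed.

(** All three exponentials preserve the span of [k], [e], [f] and [t], where each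
    of them is a polynomial of degree at most two. *)
Lemma lie_reflection_cartan (k : L) (a : K) :
  bracket k e = a *: e -> bracket k f = - (a *: f) ->
  lie_reflection k = k - a *: t.
Proof.
move=> ke kf.
have ek : bracket e k = - (a *: e) by rewrite bracketC ke.
have et : bracket e t = - (e *+ 2) by rewrite bracketC te.
have E1 : exp_ad nilp_e k = k - a *: e.
  by rewrite exp_ad1 ek // bracketNr bracketZr bracketxx scaler0 oppr0.
have Fk : exp_ad nilp_Nf k = k - a *: f.
  have fk : bracket (- f) k = - (a *: f) by rewrite bracketNl bracketC opprK kf.
  by rewrite exp_ad1 fk // bracketNr bracketZr bracketNl bracketxx oppr0 scaler0 oppr0.
have Ee : exp_ad nilp_e e = e by rewrite exp_ad1 bracketxx ?raddf0 ?addr0.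
have Et : exp_ad nilp_e t = t - e *+ 2.
  by rewrite exp_ad1 et // bracketNr bracketMnr bracketxx mul0rn oppr0.
have Fe : exp_ad nilp_Nf e = e + t - f.
  have fe : bracket (- f) e = t by rewrite bracketNl bracketC opprK ef.
  have ft : bracket (- f) t = - (f *+ 2) by rewrite bracketNl bracketC opprK tf.
  rewrite (@exp_adE _ _ _ _ 3) /= ?fe ?ft; last first.
    by rewrite bracketNr bracketMnr bracketNl bracketxx oppr0 mul0rn oppr0.
  rewrite !big_ord_recl big_ord0 /= fe ft !invr1 !scale1r addr0 addrA.
  congr (_ + _); rewrite scalerN -scaler_nat scalerA mulVf ?scale1r //.
  exact: fact_neq0.
have [ea Za] := (lie_embeddingD (exp_ad_embedding nilp_e), lie_embeddingZ (exp_ad_embedding nilp_e)).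
have [fa Zf] := (lie_embeddingD (exp_ad_embedding nilp_Nf), lie_embeddingZ (exp_ad_embedding nilp_Nf)).
rewrite /lie_reflection E1 -scaleNr fa !Zf Fk Fe.
have -> : k - a *: f + (- a) *: (e + t - f) = k + ((- a) *: t + (- a) *: e).
  rewrite !scalerDr scalerN !scaleNr opprK -!addrA; congr (_ + _).
  by rewrite addrC addrA addrK addrC.
rewrite !ea !Za E1 Et Ee scalerDr scalerN !scaleNr opprK -!addrA; congr (_ + _).
by rewrite -scalerMnr mulr2n addrK addrC addrK.
Qed.
End Reflection.

(** * Weights and the Serre relations *)

Definition simple_root n (i : 'I_n) : 'rV[int]_n := delta_mx 0 i.

Definition weight_space (K : fieldType) (L : lieAlgType K) n (A : 'M[int]_n)
    (h : 'I_n -> L) (lam : 'rV[int]_n) (x : L) : Prop :=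
  forall i, bracket (h i) x = x *~ (lam *m A) 0 i.

Lemma simple_root_pairing n (A : 'M[int]_n) i j : (simple_root i *m A) 0 j = A i j.
Proof. by rewrite -rowE mxE. Qed.

Lemma pairingN n (A : 'M[int]_n) (lam : 'rV_n) i : (- lam *m A) 0 i = - (lam *m A) 0 i.
Proof. by rewrite mulNmx mxE. Qed.

Lemma pairingD n (A : 'M[int]_n) (lam mu : 'rV_n) i :
  ((lam + mu) *m A) 0 i = (lam *m A) 0 i + (mu *m A) 0 i.
Proof. by rewrite mulmxDl mxE. Qed.

Lemma pairingZ n (A : 'M[int]_n) (lam : 'rV_n) k i :
  ((k *: lam) *m A) 0 i = k * (lam *m A) 0 i.
Proof. by rewrite -scalemxAl mxE. Qed.

Section WeightSpace.
Variables (K : fieldType) (L : lieAlgType K) (n : nat) (A : 'M[int]_n) (h : 'I_n -> L).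
Local Notation wt := (weight_space A h).

Lemma weight_space0 lam : wt lam 0.
Proof. by move=> i; rewrite bracket0r mul0rz. Qed.

Lemma weight_spaceD lam x y : wt lam x -> wt lam y -> wt lam (x + y).
Proof. by move=> Hx Hy i; rewrite bracketDr Hx Hy mulrzDl. Qed.

Lemma weight_spaceZ lam a x : wt lam x -> wt lam (a *: x).
Proof. by move=> Hx i; rewrite bracketZr Hx scalerMzr. Qed.

Lemma weight_space_bracket lam mu x y :
  wt lam x -> wt mu y -> wt (lam + mu) (bracket x y).
Proof.
move=> Hx Hy i.
by rewrite bracket_deriv Hx Hy bracketMzl bracketMzr pairingD mulrzDr.
Qed.

Lemma weight_space_swap lam x :
  weight_space A (fun i => - h i) lam x <-> wt (- lam) x.
Proof.
split=> H i; first by rewrite -[h i]opprK bracketNl H pairingN mulrNz.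
by rewrite bracketNl H pairingN mulrNz opprK.
Qed.

End WeightSpace.

Section SerreSwap.
Variables (K : fieldType) (L : lieAlgType K) (n : nat) (A : 'M[int]_n).
Variables (e f h : 'I_n -> L).

(** The Chevalley involution turns what is proved for [e] and for positive roots
    into statements on [f] and on negative roots. *)
Lemma serre_relations_swap : serre_relations A e f h ->
  serre_relations A (fun i => - f i) (fun i => - e i) (fun i => - h i).
Proof.
move=> [hh he hf ef nil]; split=> [i j|i j|i j|i j|i j ij].
- by rewrite bracketNl bracketNr hh !oppr0.
- by rewrite bracketNl bracketNr hf opprK mulNrz.
- by rewrite bracketNl bracketNr he opprK mulNrz opprK.
- rewrite bracketNl bracketNr opprK bracketC ef eq_sym.
  by case: eqP => [->|_]; rewrite ?oppr0.
- have [ne nf] := nil _ _ ij.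
  by rewrite -!scaleN1r !iter_bracket_scale !iter_bracketZ ne nf !scaler0.
Qed.

Lemma lie_span_sub (X Y : L -> Prop) :
  (forall x, X x -> lie_span Y x) -> forall x, lie_span X x -> lie_span Y x.
Proof.
move=> XY x; elim=> {x} [x /XY//||x y _ IHx _ IHy|a x _ IHx|x y _ IHx _ IHy].
- exact: lie_span0.
- exact: lie_spanD.
- exact: lie_spanZ.
- exact: lie_spanB.
Qed.

Lemma subalg_gen_swap x : subalg_gen e f h x ->
  subalg_gen (fun i => - f i) (fun i => - e i) (fun i => - h i) x.
Proof.
apply: lie_span_sub => {}x [i H].
have opp_gen (y : L) : lie_span (fun z => exists i,
    [\/ z = - f i, z = - e i | z = - h i]) (- y) ->
  lie_span (fun z => exists i, [\/ z = - f i, z = - e i | z = - h i]) y.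
  by move=> Hy; rewrite -[y]opprK -scaleN1r; apply: lie_spanZ.
by case: H => ->; apply/opp_gen/lie_span_gen; exists i;
  [apply: Or32|apply: Or31|apply: Or33].
Qed.

End SerreSwap.

Section Presented.
Variables (K : fieldType) (charK : [pchar K] =i pred0) (L : lieAlgType K).
Variables (n : nat) (A : 'M[int]_n) (e f h : 'I_n -> L).
Hypotheses (A_diag : forall i, A i i = 2) (serre : serre_relations A e f h)
  (gen : forall x, subalg_gen e f h x).
Local Notation wt := (weight_space A h).

Lemma weight_space_h i : wt 0 (h i).
Proof. by case: serre => hh _ _ _ _ j; rewrite hh mul0mx mxE. Qed.

Lemma bracket_eh i j : bracket (e i) (h j) = - (e i *~ A i j).
Proof. by case: serre => _ he _ _ _; rewrite bracketC he. Qed.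

(** Local nilpotency holds on the generators by the Serre relations, and the
    elements on which [ad (e i)] is nilpotent form a subalgebra. *)
Lemma ad_nilpotent_e i : ad_nilpotent (e i).
Proof.
case: serre => _ _ _ ef nil x.
elim: (gen x) => {x} [x [j [->|->|->]]||x y _ [N /eqP Hx] _ [M /eqP Hy]|a x _ [N /eqP Hx]
                     |x y _ [N /eqP Hx] _ [M /eqP Hy]].
- have [<-|/nil [H _]] := eqVneq i j; first by exists 1%N; rewrite /= bracketxx.
  by exists (absz (1 - A j i)); rewrite H.
- exists 3%N; rewrite /= ef; case: (i == j); last by rewrite !bracket0r.
  by rewrite bracket_eh bracketNr bracketMzr bracketxx mul0rz oppr0.
- by exists 2%N; rewrite /= bracket_eh bracketNr bracketMzr bracketxx mul0rz oppr0.
- by exists 0%N.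
- exists (maxn N M); rewrite iter_bracketD.
  by rewrite (iter_bracket_le (leq_maxl _ _) Hx) (iter_bracket_le (leq_maxr _ _) Hy) addr0.
- by exists N; rewrite iter_bracketZ Hx scaler0.
- by exists (N + M)%N; rewrite (ad_nilpotent_bracket Hx Hy).
Qed.

End Presented.

Section SimpleReflection.
Variables (K : fieldType) (charK : [pchar K] =i pred0) (L : lieAlgType K).
Variables (n : nat) (A : 'M[int]_n) (e f h : 'I_n -> L).
Hypotheses (A_diag : forall i, A i i = 2) (serre : serre_relations A e f h)
  (gen : forall x, subalg_gen e f h x).
Local Notation wt := (weight_space A h).

Definition weyl_refl i (lam : 'rV[int]_n) : 'rV[int]_n :=
  lam - (lam *m A) 0 i *: simple_root i.

(** The lift of the reflection sends [h j - A i j h i] to [h j], and so moves the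
    eigenvalues of the [h j] as the reflection moves weights. *)
Lemma simple_reflection i : exists phi : L -> L,
  lie_embedding phi /\ forall lam x, wt lam x -> wt (weyl_refl i lam) (phi x).
Proof.
have ne := ad_nilpotent_e serre gen i.
have nf := ad_nilpotent_e (serre_relations_swap serre) (fun x => subalg_gen_swap (gen x)) i.
have emb := lie_reflection_embedding charK ne nf.
exists (lie_reflection ne nf); split=> // lam x Hx j.
have [hh he hf ef _] := serre.
have E k : lie_reflection ne nf (h k) = h k - h i *~ A i k.
  rewrite -scaler_int; apply: lie_reflection_cartan; rewrite ?he ?hf ?ef ?eqxx ?scaler_int //.
  - by rewrite A_diag.
  - by rewrite A_diag.
have Ei : lie_reflection ne nf (h i) = - h i.
  by rewrite E A_diag -[2]/(2%:Z) -pmulrn mulr2n opprD addrA subrr sub0r.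
have -> : h j = lie_reflection ne nf (h j - h i *~ A i j).
  by rewrite (lie_embeddingD emb) -mulrNz (lie_embeddingMz emb) E Ei mulNrz mulrNz opprK subrK.
have [_ br _] := emb; rewrite -br -(lie_embeddingMz emb); congr (lie_reflection _ _ _).
rewrite bracketDl bracketNl bracketMzl !Hx -mulrzA -mulrzBr; congr (_ *~ _).
by rewrite pairingD pairingN pairingZ simple_root_pairing.
Qed.

End SimpleReflection.

(** * The triangular decomposition *)

Definition nonneg n (lam : 'rV[int]_n) : Prop := forall i, 0 <= lam 0 i.

Lemma simple_rootE n (i j : 'I_n) : simple_root i 0 j = (i == j)%:R.
Proof. by rewrite mxE eqxx eq_sym. Qed.

Lemma nonneg_simple_root n (i : 'I_n) : nonneg (simple_root i).
Proof. by move=> j; rewrite simple_rootE ler0n. Qed.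

Lemma nonnegD n (lam mu : 'rV[int]_n) : nonneg lam -> nonneg mu -> nonneg (lam + mu).
Proof. by move=> Hl Hm i; rewrite mxE addr_ge0. Qed.

(** The two nilpotent halves are treated at once: in what follows [(g, g')] is
    either [(e, f)], with [B = A] and [s = -1], or [(f, e)], with [B = - A] and
    [s = 1]. *)
Section Half.
Variables (K : fieldType) (L : lieAlgType K) (n : nat) (g : 'I_n -> L).

(** The span of the words of weight [lam] in the generators [g]. *)
Inductive half : 'rV[int]_n -> L -> Prop :=
| half_gen i : half (simple_root i) (g i)
| half0 lam : half lam 0
| halfD lam x y : half lam x -> half lam y -> half lam (x + y)
| halfZ lam a x : half lam x -> half lam (a *: x)
| half_bracket i lam x : half lam x -> half (simple_root i + lam) (bracket (g i) x).

Lemma half_nonneg lam x : half lam x -> x = 0 \/ nonneg lam /\ lam != 0.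
Proof.
elim=> {lam x} [i|lam|lam x y _ IHx _ IHy|lam a x _ IHx|i lam x _ IHx].
- right; split; first exact: nonneg_simple_root.
  by apply/eqP => /rowP/(_ i); rewrite simple_rootE eqxx mxE.
- by left.
- case: IHx => [->|]; last by right.
  by case: IHy => [->|]; [left; rewrite addr0|right].
- by case: IHx => [->|]; [left; rewrite scaler0|right].
- case: IHx => [->|[lam_ge0 _]]; first by left; rewrite bracket0r.
  right; split; first by apply: nonnegD => //; exact: nonneg_simple_root.
  apply/eqP => /rowP/(_ i); rewrite mxE simple_rootE eqxx mxE.
  by have := lam_ge0 i; move: (lam 0 i); lia.
Qed.

Lemma simple_rootD_multiple i j k (lam : 'rV[int]_n) :
  simple_root j + lam = k *: simple_root i -> nonneg lam ->
  j = i /\ lam = (k - 1) *: simple_root i.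
Proof.
move=> E lam_ge0; have : j = i.
  have := lam_ge0 j; move/rowP/(_ j): E; rewrite !mxE !eqxx /=.
  by have [->|] := eqVneq i j => //=; move: (lam 0 j); rewrite ?mulr0; lia.
by move=> ji; split=> //; rewrite scalerBl scale1r -E ji addrC addKr.
Qed.

Lemma half_simple lam x : half lam x ->
  forall i, lam = simple_root i -> exists a, x = a *: g i.
Proof.
elim=> {lam x} [i j E|lam i _|lam x y _ IHx _ IHy i E|lam a x _ IHx i E|j lam x Hx _ i E].
- have [<-|ne] := eqVneq i j; first by exists 1; rewrite scale1r.
  by move/rowP/(_ i): E; rewrite !simple_rootE eqxx eq_sym (negPf ne).
- by exists 0; rewrite scale0r.
- have [a ->] := IHx _ E; have [b ->] := IHy _ E.
  by exists (a + b); rewrite scalerDl.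
- by have [b ->] := IHx _ E; exists (a * b); rewrite scalerA.
- case: (half_nonneg Hx) => [->|[lam_ge0]]; first by exists 0; rewrite bracket0r scale0r.
  rewrite -[simple_root i]scale1r in E.
  by have [_ ->] := simple_rootD_multiple E lam_ge0; rewrite subrr scale0r eqxx.
Qed.

(** Such a word has a single letter, repeated, and the innermost bracket of that
    letter with itself is zero. *)
Lemma half_multiple lam x : half lam x ->
  forall i k, lam = k *: simple_root i -> 2 <= k -> x = 0.
Proof.
elim=> {lam x} [j i k E k2|//|lam x y _ IHx _ IHy i k E k2|lam a x _ IHx i k E k2
               |j lam x Hx IHx i k E k2].
- move/rowP/(_ i): E; rewrite !mxE !eqxx /= mulr1.
  by case: (i == j) => /=; lia.
- by rewrite (IHx _ _ E) // (IHy _ _ E) // addr0.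
- by rewrite (IHx _ _ E) // scaler0.
- case: (half_nonneg Hx) => [->|[lam_ge0 _]]; first by rewrite bracket0r.
  have [-> El] := simple_rootD_multiple E lam_ge0.
  have [k3|k3] := boolP (3 <= k); first by rewrite (IHx _ _ El) ?bracket0r //; lia.
  have k1 : k - 1 = 1 by lia.
  rewrite k1 scale1r in El; have [a ->] := half_simple Hx El.
  by rewrite bracketZr bracketxx scaler0.
Qed.

Variables (g' h : 'I_n -> L) (B : 'M[int]_n) (s : K).
Hypothesis hg : forall i j, bracket (h i) (g j) = g j *~ B j i.
Hypothesis gg : forall i j, bracket (g' i) (g j) = if i == j then s *: h i else 0.

Definition cartan (k : L) := exists c : 'I_n -> K, k = \sum_i c i *: h i.

Lemma cartanD k l : cartan k -> cartan l -> cartan (k + l).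
Proof.
move=> [c ->] [d ->]; exists (fun i => c i + d i); rewrite -big_split /=.
by apply: eq_bigr => i _; rewrite scalerDl.
Qed.

Lemma cartanZ a k : cartan k -> cartan (a *: k).
Proof.
move=> [c ->]; exists (fun i => a * c i); rewrite scaler_sumr.
by apply: eq_bigr => i _; rewrite scalerA.
Qed.

Lemma cartan0 : cartan 0.
Proof. by exists (fun=> 0); rewrite big1 // => i _; rewrite scale0r. Qed.

Lemma cartan_h i : cartan (h i).
Proof.
exists (fun j => (j == i)%:R); rewrite (bigD1 i) //= eqxx scale1r big1 ?addr0 //.
by move=> j /negPf ->; rewrite scale0r.
Qed.

Lemma half_weight lam x i : half lam x -> bracket (h i) x = x *~ (lam *m B) 0 i.
Proof.
elim=> {lam x} [j|lam|lam x y _ IHx _ IHy|lam a x _ IHx|j lam x _ IHx].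
- by rewrite hg simple_root_pairing.
- by rewrite bracket0r mul0rz.
- by rewrite bracketDr IHx IHy mulrzDl.
- by rewrite bracketZr IHx scalerMzr.
- by rewrite bracket_deriv hg IHx bracketMzl bracketMzr pairingD simple_root_pairing mulrzDr.
Qed.

(** A component along the Cartan subalgebra is allowed in weight zero only. *)
Definition borel lam z := exists x k,
  [/\ half lam x, cartan k, lam = 0 \/ k = 0 & z = x + k].

Lemma borel_half lam x : half lam x -> borel lam x.
Proof.
by move=> Hx; exists x, 0; split; rewrite ?addr0 //; [exact: cartan0|right].
Qed.

Lemma borelD lam x y : borel lam x -> borel lam y -> borel lam (x + y).
Proof.
move=> [x1 [k [Hx Hk Ek ->]]] [y1 [l [Hy Hl El ->]]].
exists (x1 + y1), (k + l); split; [exact: halfD|exact: cartanD| |by rewrite addrACA].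
case: Ek => [|->]; first by left.
by case: El => [|->]; [left|right; rewrite addr0].
Qed.

Lemma borelZ lam a x : borel lam x -> borel lam (a *: x).
Proof.
move=> [x1 [k [Hx Hk Ek ->]]].
exists (a *: x1), (a *: k); split; [exact: halfZ|exact: cartanZ| |by rewrite scalerDr].
by case: Ek => [|->]; [left|right; rewrite scaler0].
Qed.

Lemma bracket_borel j mu z : borel mu z -> half (simple_root j + mu) (bracket (g j) z).
Proof.
move=> [x [k [Hx [c ->] Ek ->]]]; rewrite bracketDr; apply: halfD; first exact: half_bracket.
case: Ek => [->|->]; last by rewrite bracket0r; exact: half0.
rewrite addr0 raddf_sum /=.
apply: (big_ind (half (simple_root j))) => [||i _]; [exact: half0|exact: halfD|].
rewrite bracketZr bracketC hg -scaler_int scalerN -scaleNr scalerA.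
by apply: halfZ; exact: half_gen.
Qed.

(** The opposite generator passes through the word by the Jacobi identity, and a
    component along the Cartan subalgebra arises from a single letter only. *)
Lemma lower_half i lam x : half lam x -> borel (lam - simple_root i) (bracket (g' i) x).
Proof.
elim=> {lam x} [j|lam|lam x y _ IHx _ IHy|lam a x _ IHx|j lam x Hx IHx].
- rewrite gg; case: eqP => [->|_]; last by apply: borel_half; exact: half0.
  exists 0, (s *: h j); split; rewrite ?add0r ?subrr //; first exact: half0.
    exact/cartanZ/cartan_h.
  by left.
- by rewrite bracket0r; apply: borel_half; exact: half0.
- by rewrite bracketDr; exact: borelD.
- by rewrite bracketZr; exact: borelZ.
- rewrite bracket_deriv; apply: borelD; last first.
    by rewrite -addrA; apply: borel_half; exact: bracket_borel.
  rewrite gg; case: eqP => [->|_]; last by rewrite bracket0l; apply: borel_half; exact: half0.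
  rewrite bracketZl (half_weight _ Hx) -scaler_int scalerA addrC addKr.
  by apply: borel_half; exact: halfZ.
Qed.

End Half.

Section Triangular.
Variables (K : fieldType) (charK : [pchar K] =i pred0) (L : lieAlgType K).
Variables (n : nat) (A : 'M[int]_n) (e f h : 'I_n -> L).
Hypotheses (serre : serre_relations A e f h) (gen : forall x, subalg_gen e f h x).
Hypothesis A_inj : forall lam : 'rV[int]_n, lam *m A = 0 -> lam = 0.
Local Notation wt := (weight_space A h).

(** The vectors which the triangular decomposition provides in weight [lam]; they
    turn out to be all the vectors of that weight ([weight_graded]). *)
Definition graded lam z := exists x y k,
  [/\ half e lam x, half f (- lam) y, cartan h k, lam = 0 \/ k = 0 & z = x + y + k].

Let he i j : bracket (h i) (e j) = e j *~ A j i.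
Proof. by case: serre. Qed.
Let hf i j : bracket (h i) (f j) = f j *~ (- A) j i.
Proof. by case: serre => _ _ -> _ _; rewrite mxE mulrNz. Qed.
Let fe i j : bracket (f i) (e j) = if i == j then -1 *: h i else 0.
Proof.
case: serre => _ _ _ ef _; rewrite bracketC ef eq_sym.
by case: eqP => [->|_]; rewrite ?scaleN1r ?oppr0.
Qed.
Let ef i j : bracket (e i) (f j) = if i == j then 1 *: h i else 0.
Proof. by case: serre => _ _ _ -> _; rewrite scale1r. Qed.

Lemma gradedD lam x y : graded lam x -> graded lam y -> graded lam (x + y).
Proof.
move=> [x1 [x2 [k [H1 H2 Hk Ek ->]]]] [y1 [y2 [l [G1 G2 Hl El ->]]]].
exists (x1 + y1), (x2 + y2), (k + l).
split; [exact: halfD|exact: halfD|exact: cartanD| |by rewrite addrACA [X in X + _]addrACA].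
case: Ek => [|->]; first by left.
by case: El => [|->]; [left|right; rewrite addr0].
Qed.

Lemma gradedZ lam a x : graded lam x -> graded lam (a *: x).
Proof.
move=> [x1 [x2 [k [H1 H2 Hk Ek ->]]]]; exists (a *: x1), (a *: x2), (a *: k).
split; [exact: halfZ|exact: halfZ|exact: cartanZ| |by rewrite !scalerDr].
by case: Ek => [|->]; [left|right; rewrite scaler0].
Qed.

Lemma graded_upper lam x : half e lam x -> graded lam x.
Proof.
move=> Hx; exists x, 0, 0; split=> //; [exact: half0|exact: cartan0|by right|by rewrite !addr0].
Qed.

Lemma graded_lower lam x : half f (- lam) x -> graded lam x.
Proof.
move=> Hx; exists 0, x, 0; split=> //; [exact: half0|exact: cartan0|by right|].
by rewrite add0r addr0.
Qed.

Lemma graded_cartan k : cartan h k -> graded 0 k.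
Proof.
move=> Hk; exists 0, 0, k; split=> //; [exact: half0|exact: half0|by left|].
by rewrite !add0r.
Qed.

Lemma graded_weight lam x : graded lam x -> wt lam x.
Proof.
move=> [x1 [x2 [k [H1 H2 Hk Ek ->]]]].
apply: weight_spaceD; first apply: weight_spaceD.
- by move=> i; rewrite (half_weight he i H1).
- by move=> i; rewrite (half_weight hf i H2) mulmxN mulNmx opprK.
- case: Ek => [->|->]; last exact: weight_space0.
  have [c ->] := Hk; apply: (big_ind (wt 0)) => [||i _]; [exact: weight_space0|exact: weight_spaceD|].
  by apply: weight_spaceZ; exact: (weight_space_h serre).
Qed.

Lemma graded_cartan_or lam k : cartan h k -> lam = 0 \/ k = 0 -> graded lam k.
Proof. by move=> Hk [->|->]; [exact: graded_cartan|apply: graded_upper; exact: half0]. Qed.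

Lemma graded_e i lam x : graded lam x -> graded (simple_root i + lam) (bracket (e i) x).
Proof.
move=> [x1 [x2 [k [H1 H2 Hk Ek ->]]]]; rewrite !bracketDr.
apply: gradedD; first apply: gradedD.
- by apply: graded_upper; exact: half_bracket.
- have [y [l [Hy Hl El ->]]] := lower_half hf ef i H2.
  apply: gradedD; first by apply: graded_lower; rewrite opprD addrC.
  apply: graded_cartan_or => //; case: El => [El|]; [left|by right].
  by apply/eqP; rewrite -oppr_eq0 opprD addrC El.
- apply: graded_upper; apply: (bracket_borel he).
  by exists 0, k; split; rewrite ?add0r //; exact: half0.
Qed.

Lemma graded_f i lam x : graded lam x -> graded (- simple_root i + lam) (bracket (f i) x).
Proof.
move=> [x1 [x2 [k [H1 H2 Hk Ek ->]]]]; rewrite !bracketDr.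
apply: gradedD; first apply: gradedD.
- have [y [l [Hy Hl El ->]]] := lower_half he fe i H1.
  rewrite addrC; apply: gradedD; first exact: graded_upper.
  exact: graded_cartan_or.
- by apply: graded_lower; rewrite opprD opprK; exact: half_bracket.
- apply: graded_lower; rewrite opprD opprK; apply: (bracket_borel hf).
  exists 0, k; split; rewrite ?add0r //; first exact: half0.
  by case: Ek => [->|]; [left; rewrite oppr0|right].
Qed.

Definition graded_sum x := exists s : seq ('rV[int]_n * L),
  (forall p, p \in s -> graded p.1 p.2) /\ x = \sum_(p <- s) p.2.

Lemma graded_sum1 lam x : graded lam x -> graded_sum x.
Proof.
move=> Hx; exists [:: (lam, x)]; split; last by rewrite big_seq1.
by move=> p; rewrite inE => /eqP ->.
Qed.

Lemma graded_sumD x y : graded_sum x -> graded_sum y -> graded_sum (x + y).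
Proof.
move=> [s [Hs ->]] [t [Ht ->]]; exists (s ++ t); split; last by rewrite big_cat.
by move=> p; rewrite mem_cat => /orP[/Hs|/Ht].
Qed.

Lemma graded_sum_map (F : L -> L) (w : 'rV[int]_n -> 'rV[int]_n) x :
  (forall y z, F (y + z) = F y + F z) -> F 0 = 0 ->
  (forall lam y, graded lam y -> graded (w lam) (F y)) -> graded_sum x -> graded_sum (F x).
Proof.
move=> FD F0 HF [s [Hs ->]]; exists [seq (w p.1, F p.2) | p <- s]; split.
  by move=> p /mapP[q /Hs Hq ->]; exact: HF.
by rewrite big_map; apply: big_morph.
Qed.

(** The sums of homogeneous vectors contain the generators and are stable under
    bracketing with them, hence form an ideal containing the generators. *)
Lemma graded_sum_all x : graded_sum x.
Proof.
have stable z : forall y, graded_sum y -> graded_sum (bracket z y).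
  elim: (gen z) => {z} [z [i [->|->|->]]||z1 z2 _ IH1 _ IH2|a z _ IH|z1 z2 _ IH1 _ IH2] y Hy.
  - apply: (graded_sum_map (F := bracket (e i))) Hy;
    [by move=> *; exact: bracketDr|exact: bracket0r|exact: graded_e].
  - apply: (graded_sum_map (F := bracket (f i))) Hy;
    [by move=> *; exact: bracketDr|exact: bracket0r|exact: graded_f].
  - apply: (graded_sum_map (F := bracket (h i)) (w := id)) Hy;
    [by move=> *; exact: bracketDr|exact: bracket0r|].
    by move=> lam v Hv; rewrite (graded_weight Hv) -scaler_int; exact: gradedZ.
  - by rewrite bracket0l; apply: (@graded_sum1 0); apply: graded_upper; exact: half0.
  - by rewrite bracketDl; apply: graded_sumD; [exact: IH1|exact: IH2].
  - rewrite bracketZl; have := IH _ Hy.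
    apply: (graded_sum_map (F := *:%R a) (w := id)) => [u v||]; rewrite ?scaler0 ?scalerDr //.
    by move=> lam v; exact: gradedZ.
  - have -> : bracket (bracket z1 z2) y
              = bracket z1 (bracket z2 y) + (-1) *: bracket z2 (bracket z1 y).
      by rewrite scaleN1r bracket_deriv addrK.
    apply: graded_sumD; first exact/IH1/IH2.
    have : graded_sum (bracket z2 (bracket z1 y)) by apply/IH2/IH1.
    apply: (graded_sum_map (F := *:%R (-1)) (w := id)) => [u v||]; rewrite ?scaler0 ?scalerDr //.
    by move=> lam v; exact: gradedZ.
elim: (gen x) => {x} [x [i [->|->|->]]||x y _ IHx _ IHy|a x _ IHx|x y _ _ _ IHy].
- by apply/graded_sum1/graded_upper/half_gen.
- by apply: (@graded_sum1 (- simple_root i)); apply: graded_lower; rewrite opprK; exact: half_gen.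
- exact/graded_sum1/graded_cartan/cartan_h.
- by apply: (@graded_sum1 0); apply: graded_upper; exact: half0.
- exact: graded_sumD.
- move: IHx; apply: (graded_sum_map (F := *:%R a) (w := id)) => [u v||]; rewrite ?scaler0 ?scalerDr //.
  by move=> lam v; exact: gradedZ.
- exact: stable.
Qed.

Lemma intr_char0_neq0 (k : int) : k != 0 -> (k%:~R : K) != 0.
Proof.
case: k => m k0; first by rewrite -pmulrn (pcharf0P K).1.
by rewrite NegzE mulrNz oppr_eq0 -pmulrn (pcharf0P K).1.
Qed.

(** Weights are separated by the simple coroots, so a weight vector equals its
    component of the same weight. *)
Lemma weight_graded lam x : wt lam x -> graded lam x.
Proof.
suff H N (s : seq ('rV[int]_n * L)) : size s = N ->
    (forall p, p \in s -> graded p.1 p.2) ->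
    forall y z, graded lam y -> z = y + \sum_(p <- s) p.2 -> wt lam z -> graded lam z.
  move=> Hx; have [s [Hs E]] := graded_sum_all x.
  by apply: (H _ s erefl Hs 0) => //; [apply: graded_upper; exact: half0|rewrite add0r].
elim: N s => [|N IH] s.
  by move=> /size0nil -> _ y z Hy ->; rewrite big_nil addr0.
case: s => [//|p s] [sz] Hs y z Hy Ez Hz.
have Hp : graded p.1 p.2 by apply: Hs; rewrite mem_head.
have {}Hs q : q \in s -> graded q.1 q.2 by move=> qs; apply: Hs; rewrite inE qs orbT.
rewrite big_cons in Ez.
have [Ep|ne] := eqVneq p.1 lam.
  by apply: (IH s sz Hs (y + p.2)) => //; [apply: gradedD => //; rewrite -Ep|rewrite -addrA].
have [i Hi] : exists i, (lam *m A) 0 i != (p.1 *m A) 0 i.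
  apply/existsP; apply: contra_neqT ne; rewrite negb_exists => /forallP E.
  apply/eqP; rewrite -subr_eq0; apply/eqP/A_inj/rowP => i; rewrite mulmxBl !mxE.
  by move/(_ i): E; rewrite negbK !mxE => /eqP ->; rewrite subrr.
pose c := ((lam *m A) 0 i - (p.1 *m A) 0 i)%:~R : K.
have c0 : c != 0 by apply: intr_char0_neq0; rewrite subr_eq0.
(* P is 1 on the vectors of weight lam and 0 on those of weight p.1. *)
pose P v := c^-1 *: (bracket (h i) v - v *~ (p.1 *m A) 0 i).
have Pw mu v : wt mu v -> P v = (c^-1 * ((mu *m A) 0 i - (p.1 *m A) 0 i)%:~R) *: v.
  by move=> Hv; rewrite /P Hv -mulrzBr -scaler_int scalerA.
have Plam v : wt lam v -> P v = v by move=> Hv; rewrite (Pw _ _ Hv) mulVf ?scale1r.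
have PD u v : P (u + v) = P u + P v.
  by rewrite /P bracketDr mulrzDl opprD addrACA scalerDr.
have P0 : P 0 = 0 by rewrite /P bracket0r mul0rz subr0 scaler0.
apply: (IH [seq (q.1, P q.2) | q <- s] _ _ y) => //; first by rewrite size_map.
  move=> _ /mapP[q /Hs Hq ->] /=; rewrite (Pw _ _ (graded_weight Hq)); exact: gradedZ.
rewrite -[LHS](Plam _ Hz) Ez !PD (Plam _ (graded_weight Hy)) big_map.
rewrite (Pw _ _ (graded_weight Hp)) subrr mulr0 scale0r add0r; congr (_ + _).
exact: (big_morph P).
Qed.

Lemma weight_sign lam x : wt lam x -> x != 0 -> nonneg lam \/ nonneg (- lam).
Proof.
move=> /weight_graded [x1 [x2 [k [H1 H2 Hk Ek ->]]]].
case: (half_nonneg H1) => [->|[? _]]; last by left.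
case: (half_nonneg H2) => [->|[? _]]; last by right.
case: Ek => [-> _|->]; last by rewrite !addr0 eqxx.
by left=> i; rewrite mxE.
Qed.

Lemma nonneg_anti (lam : 'rV[int]_n) : nonneg lam -> nonneg (- lam) -> lam = 0.
Proof.
move=> H1 H2; apply/rowP => i; have := H1 i; have := H2 i; rewrite !mxE.
by move: (lam 0 i); lia.
Qed.

Lemma weight_positive lam x : nonneg lam -> lam != 0 -> wt lam x -> half e lam x.
Proof.
move=> lam_ge0 lam0 /weight_graded [x1 [x2 [k [H1 H2 Hk Ek ->]]]].
case: (half_nonneg H2) => [->|[lam_le0 _]]; last first.
  by move: lam0; rewrite (nonneg_anti lam_ge0 lam_le0) eqxx.
by case: Ek => [E|->]; [rewrite E eqxx in lam0|rewrite !addr0].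
Qed.

Lemma simple_root_neq0 i : simple_root i != 0 :> 'rV[int]_n.
Proof. by apply/eqP => /rowP/(_ i); rewrite simple_rootE eqxx mxE. Qed.

Lemma weight_simple i x : wt (simple_root i) x -> exists a, x = a *: e i.
Proof.
move=> /(weight_positive (nonneg_simple_root i) (simple_root_neq0 i)) Hx.
exact: (half_simple Hx).
Qed.

Lemma weight_multiple i k x : 2 <= k -> wt (k *: simple_root i) x -> x = 0.
Proof.
move=> k2 Hx; apply: (half_multiple (weight_positive _ _ Hx) (erefl _) k2).
  by move=> j; rewrite mxE; apply: mulr_ge0; [lia|exact: nonneg_simple_root].
apply/eqP => /rowP/(_ i); rewrite [LHS]mxE simple_rootE eqxx mulr1 mxE => k0.
by rewrite k0 in k2.
Qed.

End Triangular.

(** * Roots of positive norm *)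

Section Form.
Variables (n : nat) (A : 'M[int]_n) (D : 'I_n -> int).
Hypotheses (A_diag : forall i, A i i = 2) (AD : forall i j, A i j * D j = A j i * D i).

(** For the diagonal matrix with entries [D j] symmetrizing [A], this is an
    integral multiple of the invariant form. *)
Definition root_form (lam mu : 'rV[int]_n) : int := \sum_j (lam *m A) 0 j * D j * mu 0 j.
Local Notation Q := root_form.

Lemma root_formDl lam mu nu : Q (lam + mu) nu = Q lam nu + Q mu nu.
Proof.
by rewrite -big_split; apply: eq_bigr => j _; rewrite pairingD !mulrDl.
Qed.

Lemma root_formZl k lam mu : Q (k *: lam) mu = k * Q lam mu.
Proof.
by rewrite mulr_sumr; apply: eq_bigr => j _; rewrite pairingZ !mulrA.
Qed.

Lemma root_formC lam mu : Q lam mu = Q mu lam.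
Proof.
transitivity (\sum_j \sum_i lam 0 i * (A i j * D j) * mu 0 j).
  by apply: eq_bigr => j _; rewrite mxE !mulr_suml; apply: eq_bigr => i _; rewrite !mulrA.
rewrite exchange_big; apply: eq_bigr => j _.
rewrite mxE !mulr_suml; apply: eq_bigr => i _; rewrite AD; ring.
Qed.

Lemma root_formDr lam mu nu : Q nu (lam + mu) = Q nu lam + Q nu mu.
Proof. by rewrite !(root_formC nu) root_formDl. Qed.

Lemma root_formZr k lam mu : Q mu (k *: lam) = k * Q mu lam.
Proof. by rewrite !(root_formC mu) root_formZl. Qed.

Lemma root_formNl lam mu : Q (- lam) mu = - Q lam mu.
Proof. by rewrite -scaleN1r root_formZl mulN1r. Qed.

Lemma root_formNr lam mu : Q mu (- lam) = - Q mu lam.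
Proof. by rewrite -scaleN1r root_formZr mulN1r. Qed.

Lemma root_form_simple lam i : Q lam (simple_root i) = (lam *m A) 0 i * D i.
Proof.
rewrite /root_form (bigD1 i) //= simple_rootE eqxx mulr1 big1 ?addr0 // => j /negPf ji.
by rewrite simple_rootE eq_sym ji mulr0.
Qed.

Lemma root_form_weyl_refl i lam mu : Q (weyl_refl A i lam) (weyl_refl A i mu) = Q lam mu.
Proof.
rewrite /weyl_refl !(root_formDl, root_formDr, root_formNl, root_formNr, root_formZl, root_formZr).
rewrite (root_formC (simple_root i) mu) !root_form_simple simple_root_pairing A_diag; ring.
Qed.

Lemma weyl_reflE i (lam : 'rV[int]_n) k :
  (weyl_refl A i lam) 0 k = lam 0 k - (lam *m A) 0 i * (i == k)%:R.
Proof.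
by rewrite /weyl_refl mxE; congr (_ + _); rewrite mxE; congr (- _); rewrite mxE simple_rootE.
Qed.

Lemma weyl_reflN i lam : weyl_refl A i (- lam) = - weyl_refl A i lam.
Proof. by rewrite /weyl_refl pairingN scaleNr opprB opprK addrC. Qed.

End Form.

Section RealRoots.
Variables (K : fieldType) (charK : [pchar K] =i pred0) (L : lieAlgType K).
Variables (n : nat) (A : 'M[int]_n) (e f h : 'I_n -> L) (D : 'I_n -> int).
Hypotheses (serre : serre_relations A e f h) (gen : forall x, subalg_gen e f h x).
Hypothesis A_inj : forall lam : 'rV[int]_n, lam *m A = 0 -> lam = 0.
Hypotheses (A_diag : forall i, A i i = 2) (AD : forall i j, A i j * D j = A j i * D i).
Hypothesis D_gt0 : forall i, 0 < D i.
Local Notation wt := (weight_space A h).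
Local Notation Q := (root_form A D).

(** [beta] is the image of a simple root under the Weyl group, the group element
    being lifted to the Lie algebra. *)
Definition conj_to_simple beta := exists i (phi : L -> L) (w : 'rV[int]_n -> 'rV[int]_n),
  [/\ lie_embedding phi, forall lam z, wt lam z -> wt (w lam) (phi z),
      forall lam mu, Q (w lam) (w mu) = Q lam mu,
      forall lam, w (- lam) = - w lam & w beta = simple_root i].

(** The coefficients of the coroot of [beta] on the simple coroots are integers. *)
Definition integral_coroot (beta : 'rV[int]_n) :=
  forall j, (Q beta beta %| (2 * beta 0 j * D j)%R)%Z.

Lemma conj_simple i : conj_to_simple (simple_root i) /\ integral_coroot (simple_root i).
Proof.
split; first by exists i, idfun, id; split=> //; exact: lie_embedding_id.
move=> j; rewrite root_form_simple simple_root_pairing A_diag simple_rootE.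
by case: eqP => [->|_]; rewrite ?mulr0 ?mul0r ?dvdz0 // mulr1.
Qed.

(** The pairing of a simple root with the coroot is an integer as soon as the
    coroot is integral, so a reflection preserves integrality. *)
Lemma conj_refl i beta :
  conj_to_simple (weyl_refl A i beta) /\ integral_coroot (weyl_refl A i beta) ->
  conj_to_simple beta /\ integral_coroot beta.
Proof.
move=> [[k [phi [w [emb Hw Qw Nw Ew]]]] Hint]; split.
  have [psi [emb' Hpsi]] := simple_reflection charK A_diag serre gen i.
  exists k, (phi \o psi), (w \o weyl_refl A i); split => //=.
  - exact: lie_embedding_comp.
  - by move=> lam z /Hpsi /Hw.
  - by move=> lam mu; rewrite Qw root_form_weyl_refl.
  - by move=> lam; rewrite weyl_reflN.
set beta' := weyl_refl A i beta in Hint.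
have Eb : beta = beta' + (beta *m A) 0 i *: simple_root i by rewrite /beta' /weyl_refl subrK.
have Ep : (beta *m A) 0 i = - (beta' *m A) 0 i.
  by rewrite [in RHS]/beta' /weyl_refl pairingD pairingN pairingZ simple_root_pairing A_diag; ring.
have EQ : Q beta beta = Q beta' beta' by rewrite root_form_weyl_refl.
move=> j; rewrite EQ {1}Eb mxE mulrDr mulrDl rpredD ?Hint // mxE simple_rootE.
case: eqP => [<-|_]; last by rewrite !mulr0 mul0r dvdz0.
rewrite mulr1 Ep.
have -> : 2 * - (beta' *m A) 0 i * D i = - (\sum_l A i l * (2 * beta' 0 l * D l)).
  rewrite -[LHS]/(2 * - _ * D i) mulrN mulNr -mulrA -root_form_simple (root_formC AD).
  rewrite mulr_sumr; congr (- _); apply: eq_bigr => l _; rewrite simple_root_pairing; ring.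
by rewrite rpredN; apply: rpred_sum => l _; exact: dvdz_mull.
Qed.

(** If [(beta, beta) > 0] then some simple reflection lowers the height of [beta].
    This descent can only leave the positive roots from a multiple of a simple
    root, and among those multiples only the simple root itself is a root. *)
Lemma positive_norm_real beta x : nonneg beta -> 0 < Q beta beta -> wt beta x -> x != 0 ->
  conj_to_simple beta /\ integral_coroot beta.
Proof.
have [N] := ubnP (absz (\sum_i beta 0 i)%R).
elim: N beta x => // N IH beta x ltN beta_ge0 Qb Hx x0.
have ht_ge0 : 0 <= \sum_i beta 0 i by apply: sumr_ge0 => i _; exact: beta_ge0.
have [i Hi] : exists i, 0 < (beta *m A) 0 i * D i * beta 0 i.
  apply/existsP; apply: contraTT Qb; rewrite negb_exists => /forallP H.
  by rewrite -leNgt; apply: sumr_le0 => i _; rewrite leNgt; exact: H.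
set p := (beta *m A) 0 i in Hi.
have p0 : 0 < p.
  have := beta_ge0 i; have := D_gt0 i; move: Hi; move: (D i) (beta 0 i) => d b Hi d0 b0.
  have b1 : 0 < b by rewrite lt_neqAle b0 andbT; apply: contraTneq Hi => <-; rewrite mulr0 ltxx.
  by move: Hi; rewrite pmulr_lgt0 // pmulr_lgt0.
have [psi [emb Hpsi]] := simple_reflection charK A_diag serre gen i.
have Hx' := Hpsi _ _ Hx.
have x'0 : psi x != 0 by case: emb => _ _ inj; apply: contraNneq x0 => /inj ->.
have [ge0|le0] := weight_sign charK serre gen A_inj Hx' x'0.
  apply: (conj_refl (i := i)); apply: (IH _ _ _ ge0 _ Hx' x'0); last by rewrite root_form_weyl_refl.
  have ht'_ge0 : 0 <= \sum_k (weyl_refl A i beta) 0 k by apply: sumr_ge0 => k _; exact: ge0.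
  have : \sum_k (weyl_refl A i beta) 0 k = \sum_k beta 0 k - p.
    transitivity (\sum_k (beta 0 k - p * (i == k)%:R)).
      by apply: eq_bigr => k _; exact: weyl_reflE.
    rewrite sumrB; congr (_ - _).
    rewrite (bigD1 i) //= eqxx mulr1 big1 ?addr0 // => k.
    by rewrite eq_sym => /negPf ->; rewrite mulr0.
  by move: ltN ht_ge0 ht'_ge0 p0; move: (\sum_k _) (\sum_k _) => a b; lia.
have Eb : beta = beta 0 i *: simple_root i.
  apply/rowP => k; rewrite mxE simple_rootE.
  have := beta_ge0 k; have := le0 k; rewrite mxE weyl_reflE.
  case: (i =P k) => [<- _ _|_]; first by rewrite mulr1.
  by move: (beta 0 k) => b; rewrite !mulr0; lia.
have [k2|k1] := boolP (2 <= beta 0 i).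
  by case/eqP: x0; apply: (weight_multiple charK serre gen A_inj (i := i) k2); rewrite -Eb.
suff -> : beta = simple_root i by exact: conj_simple.
rewrite Eb; suff -> : beta 0 i = 1 by rewrite scale1r.
have := beta_ge0 i; move: k1; have : beta 0 i != 0.
  by apply: contraTneq Hi => ->; rewrite mulr0 ltxx.
by move: (beta 0 i); lia.
Qed.

(** After rescaling, opposite root vectors of a positive root of positive norm
    bracket to the coroot, because this holds for the simple root conjugate to
    it. *)
Lemma real_root_coroot beta x y : nonneg beta -> 0 < Q beta beta ->
  wt beta x -> wt (- beta) y -> x != 0 -> y != 0 ->
  exists c : K, [/\ c != 0, ad_nilpotent x, ad_nilpotent y
    & forall lam z (t : int), wt lam z -> t * Q beta beta = 2 * Q lam beta ->
      bracket (bracket x (c *: y)) z = z *~ t].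
Proof.
move=> beta_ge0 Qb Hx Hy x0 y0.
have [[i [phi [w [emb Hw Qw Nw Ew]]]] _] := positive_norm_real beta_ge0 Qb Hx x0.
have serre' := serre_relations_swap serre.
have gen' z := subalg_gen_swap (gen z).
have [_ br inj] := emb.
have [a Ea] : exists a, phi x = a *: e i.
  by apply: (weight_simple charK serre gen A_inj); rewrite -Ew; exact: Hw.
have [b Eb] : exists b, phi y = b *: f i.
  have /weight_space_swap/(weight_simple charK serre' gen' A_inj) [b ->] :
    wt (- simple_root i) (phi y) by rewrite -Ew -Nw; exact: Hw.
  by exists (- b); rewrite scalerN scaleNr.
have a0 : a != 0.
  by apply: contraNneq x0 => a0; apply/eqP/inj; rewrite Ea a0 scale0r.
have b0 : b != 0.
  by apply: contraNneq y0 => b0; apply/eqP/inj; rewrite Eb b0 scale0r.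
exists ((a * b)^-1); split.
- by rewrite invr_neq0 // mulf_neq0.
- apply: (lie_embedding_nilp emb); rewrite Ea; apply: ad_nilpotentZ; exact: ad_nilpotent_e serre gen i.
- apply: (lie_embedding_nilp emb); rewrite Eb -[f i]opprK scalerN -scaleNr.
  by apply: ad_nilpotentZ; exact: ad_nilpotent_e serre' gen' i.
- move=> lam z t Hz Et; apply: (lie_embedding_inj emb).
  rewrite !br (lie_embeddingMz emb) (lie_embeddingZ emb) Ea Eb.
  rewrite scalerA bracketZl bracketZr scalerA.
  have -> : a * ((a * b)^-1 * b) = 1 by rewrite invfM -mulrA mulVf // mulr1 divff.
  have -> : bracket (e i) (f i) = h i by case: serre => _ _ _ -> _; rewrite eqxx.
  rewrite scale1r (Hw _ _ Hz); congr (_ *~ _).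
  apply: (@mulIf _ (2 * D i)); first by rewrite mulf_neq0 ?lt0r_neq0.
  have Qbb : Q beta beta = 2 * D i.
    by rewrite -Qw Ew root_form_simple simple_root_pairing A_diag.
  by rewrite -Qbb Et Qbb mulrCA -root_form_simple -Ew Qw.
Qed.

End RealRoots.

(** * Subalgebras generated by real root vectors *)

Section Sl2.
Variables (K : fieldType) (charK : [pchar K] =i pred0) (L : lieAlgType K).

(** A lowest weight vector of weight [-m] for an sl2-triple whose raising
    operator is locally nilpotent generates a module of dimension at most
    [m + 1]: lowering the last nonzero power of the raising operator multiplies
    it by an integer that is nonzero beyond that power. *)
Lemma lowest_weight_bound (E F H v : L) (m : nat) :
  bracket E F = H -> bracket H E = E *~ 2 -> bracket F v = 0 ->
  bracket H v = v *~ (- m%:Z) -> ad_nilpotent E -> iter m.+1 (bracket E) v = 0.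
Proof.
move=> EF HE Fv Hv nilp.
have Hk k : bracket H (iter k (bracket E) v) = iter k (bracket E) v *~ (2 * k%:Z - m%:Z).
  elim: k => [|k IH] /=; first by rewrite Hv mulr0 sub0r.
  rewrite bracket_deriv HE IH bracketMzl bracketMzr -mulrzDr; congr (_ *~ _); lia.
have Fk k : bracket F (iter k.+1 (bracket E) v)
            = iter k (bracket E) v *~ (k.+1%:Z * (m%:Z - k%:Z)).
  elim: k => [|k IH].
    rewrite /= bracket_deriv Fv bracket0r addr0 [bracket F E]bracketC EF bracketNl Hv -mulrNz.
    by congr (_ *~ _); lia.
  rewrite iterS bracket_deriv IH bracketMzr [bracket F E]bracketC EF bracketNl Hk -iterS.
  by rewrite -mulrNz -mulrzDr; congr (_ *~ _); lia.
case/ex_minnP: (nilp v) => N /eqP HN Hmin.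
have [leN|ltN] := leqP N m.+1; first exact: iter_bracket_le leN HN.
case: N => [//|N] in HN Hmin ltN *.
have : iter N (bracket E) v *~ (N.+1%:Z * (m%:Z - N%:Z)) = 0 by rewrite -Fk HN bracket0r.
rewrite -scaler_int => /eqP; rewrite scaler_eq0 => /orP[|/Hmin]; last by rewrite ltnn.
by rewrite (negPf (intr_char0_neq0 charK _)) // mulf_neq0 // subr_eq0; apply/eqP; lia.
Qed.

End Sl2.

Section RootSubalgebra.
Variables (K : fieldType) (charK : [pchar K] =i pred0) (L : lieAlgType K).
Variables (n : nat) (A : 'M[int]_n) (h : 'I_n -> L) (D : 'I_n -> int).
Local Notation wt := (weight_space A h).
Local Notation Q := (root_form A D).

(** Once the [H i] act by the coroots and distinct [E i], [F j] commute, the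
    remaining Serre relations are statements about sl2-triples. *)
Lemma root_vectors_serre p (C : 'M[int]_p) (beta : 'I_p -> 'rV[int]_n) (E F : 'I_p -> L) :
  (forall i, wt (beta i) (E i)) -> (forall i, wt (- beta i) (F i)) ->
  (forall i, ad_nilpotent (E i)) -> (forall i, ad_nilpotent (F i)) ->
  (forall i j, i != j -> bracket (E i) (F j) = 0) ->
  (forall i lam z (t : int), wt lam z ->
     t * Q (beta i) (beta i) = 2 * Q lam (beta i) ->
     bracket (bracket (E i) (F i)) z = z *~ t) ->
  (forall i j, C i j * Q (beta j) (beta j) = 2 * Q (beta i) (beta j)) ->
  (forall i, C i i = 2) -> (forall i j, i != j -> C i j <= 0) ->
  serre_relations C E F (fun i => bracket (E i) (F i)).
Proof.
move=> wE wF nE nF EF act CQ C2 C_le0.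
have HE i j : bracket (bracket (E i) (F i)) (E j) = E j *~ C j i.
  by apply: act (wE j) _; rewrite CQ.
have HF i j : bracket (bracket (E i) (F i)) (F j) = - (F j *~ C j i).
  by rewrite -mulrNz; apply: act (wF j) _; rewrite mulNr CQ (root_formNl A D) mulrN.
split=> // [i j|i j|i j ij].
- rewrite (act i 0 _ 0) ?mulr0z ?mul0r //.
    by rewrite -(subrr (beta j)); apply: weight_space_bracket.
  by rewrite -(scale0r 0) (root_formZl A D) mul0r mulr0.
- by case: eqP => [->//|/eqP/EF].
- (* The lowest weight of E j for the sl2-triple of index i is C j i <= 0. *)
  have C_neg : C j i = - `|C j i|%N%:Z 
    by have := C_le0 j i; rewrite eq_sym => /(_ ij); move: (C j i) => k; lia.
  have -> : `|1 - C j i|%N = `|C j i|%N.+1.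
    by have := C_le0 j i; rewrite eq_sym => /(_ ij); move: (C j i) => k; lia.
  split.
    apply: (@lowest_weight_bound _ charK _ _ (F i) _ _ _ (erefl _) _ _ _ (nE i)).
    - by rewrite HE C2.
    - by rewrite bracketC EF ?oppr0 // eq_sym.
    - by rewrite HE -C_neg.
  apply: (@lowest_weight_bound _ charK _ _ (E i) (- bracket (E i) (F i)) _ _ _ _ _ _ (nF i)).
  - by rewrite bracketC.
  - by rewrite bracketNl HF C2 opprK.
  - exact: EF.
  - by rewrite bracketNl HF opprK -C_neg.
Qed.

Variables (e f : 'I_n -> L).
Hypotheses (serre : serre_relations A e f h) (gen : forall x, subalg_gen e f h x).
Hypothesis A_inj : forall lam : 'rV[int]_n, lam *m A = 0 -> lam = 0.
Hypotheses (A_diag : forall i, A i i = 2) (D_gt0 : forall i, 0 < D i).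

Lemma mixed_sign_not_weight (lam : 'rV[int]_n) i j x : 0 < lam 0 i -> lam 0 j < 0 -> wt lam x -> x = 0.
Proof.
move=> pos neg Hx; apply/eqP/contraT => x0.
have [/(_ j)|/(_ i)] := weight_sign charK serre gen A_inj Hx x0; first by rewrite leNgt neg.
by rewrite mxE oppr_ge0 leNgt pos.
Qed.

End RootSubalgebra.

Section NotRoot.
Variables (K : fieldType) (charK : [pchar K] =i pred0) (L : lieAlgType K).
Variables (n : nat) (A : 'M[int]_n) (e f h : 'I_n -> L) (D : 'I_n -> int).
Hypotheses (serre : serre_relations A e f h) (gen : forall x, subalg_gen e f h x).
Hypothesis A_inj : forall lam : 'rV[int]_n, lam *m A = 0 -> lam = 0.
Hypotheses (A_diag : forall i, A i i = 2) (AD : forall i j, A i j * D j = A j i * D i).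
Hypothesis D_gt0 : forall i, 0 < D i.
Local Notation wt := (weight_space A h).
Local Notation Q := (root_form A D).

(** Being real, a root of positive norm has an integral coroot; this excludes
    weights that the signs of the coordinates leave possible. *)
Lemma not_integral_not_weight lam x : nonneg lam -> 0 < Q lam lam ->
  ~ integral_coroot A D lam -> wt lam x \/ wt (- lam) x -> x = 0.
Proof.
move=> ge0 pos nint Hx; apply/eqP/contraT => x0; case: nint.
case: Hx => Hx; first by case: (positive_norm_real charK serre gen A_inj A_diag AD D_gt0 ge0 pos Hx x0).
have serre' := serre_relations_swap serre.
have gen' z := subalg_gen_swap (gen z).
have /weight_space_swap Hx' : wt (- lam) x := Hx.
by case: (positive_norm_real charK serre' gen' A_inj A_diag AD D_gt0 ge0 pos Hx' x0).
Qed.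

End NotRoot.

(** * The roots of an over-extended algebra *)

Section OverExtended.
Variables (r : nat) (A : 'M[int]_r.+2) (marks : 'rV[int]_r.+1) (m : nat) (D : 'I_r.+2 -> int).
Hypotheses (A_gcm : gcm A) (marks_null : null_root_marks A marks).
Hypothesis A01 : A ord0 (lift ord0 ord0) = -1.
Hypothesis A10 : A (lift ord0 ord0) ord0 = -1.
Hypothesis A0j : forall j : 'I_r.+1, j != ord0 ->
  A ord0 (lift ord0 j) = 0 /\ A (lift ord0 j) ord0 = 0.
Hypotheses (AD : forall i j, A i j * D j = A j i * D i) (D_gt0 : forall i, 0 < D i).
Hypothesis D1 : (0 < m)%N -> forall i : 'I_r.+1, i = 1%N :> nat -> D (lift ord0 i) = D ord0.
Local Notation Q := (root_form A D).

Definition int_null_root : 'rV[int]_r.+2 := \sum_j marks 0 j *: simple_root (lift ord0 j).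
Local Notation delta := int_null_root.

(** The multiple of the null root that [beta] adds to [alpha_j]. *)
Definition shift (j : 'I_r.+1) : int := if j == 1%N :> nat then m%:Z else 0.

Definition int_beta (j : 'I_r.+1) : 'rV[int]_r.+2 :=
  if j == ord0 then simple_root ord0 else shift j *: delta + simple_root (lift ord0 j).

Definition beta_matrix : 'M[int]_r.+1 := \matrix_(i, j)
  if i == ord0 then border m j else if j == ord0 then border m i
  else A (lift ord0 i) (lift ord0 j).

Lemma int_beta_ord0 : int_beta ord0 = simple_root ord0.
Proof. by rewrite /int_beta eqxx. Qed.

Lemma null_root0 : delta 0 ord0 = 0.
Proof.
rewrite summxE big1 // => j _; rewrite mxE simple_rootE.
by rewrite eq_sym (negPf (neq_lift _ _)) mulr0.
Qed.

Lemma null_rootS j : delta 0 (lift ord0 j) = marks 0 j.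
Proof.
rewrite summxE (bigD1 j) //= mxE simple_rootE eqxx mulr1 big1 ?addr0 // => i /negPf ij.
by rewrite mxE simple_rootE (inj_eq lift_inj) ij mulr0.
Qed.

Lemma null_root_pairing j : (delta *m A) 0 (lift ord0 j) = 0.
Proof.
have [_ /rowP/(_ j) null _] := marks_null; move: null; rewrite !mxE => null.
rewrite big_ord_recl null_root0 mul0r add0r -[RHS]null; apply: eq_bigr => i _.
by rewrite null_rootS !mxE.
Qed.

Lemma null_root_pairing0 : (delta *m A) 0 ord0 = -1.
Proof.
have [_ _ marks0] := marks_null.
rewrite mxE !big_ord_recl null_root0 mul0r add0r null_rootS marks0 A10 mul1r big1 ?addr0 //.
by move=> i _; rewrite (A0j _).2 ?mulr0 // eq_sym neq_lift.
Qed.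

Lemma null_root_form j : Q delta (simple_root (lift ord0 j)) = 0.
Proof. by rewrite root_form_simple null_root_pairing mul0r. Qed.

Lemma null_root_isotropic : Q delta delta = 0.
Proof.
rewrite {2}/int_null_root; apply: (big_ind (fun mu => Q delta mu = 0)).
- by rewrite -(scale0r 0) root_formZr // mul0r.
- by move=> mu nu H1 H2; rewrite root_formDr // H1 H2 addr0.
- by move=> j _; rewrite root_formZr // null_root_form mulr0.
Qed.

Lemma D_affine : D (lift ord0 ord0) = D ord0.
Proof. by have := AD ord0 (lift ord0 ord0); rewrite A01 A10 !mulN1r => /oppr_inj. Qed.

Lemma int_beta_form0 j : j != ord0 -> Q (simple_root ord0) (int_beta j) = - shift j * D ord0.
Proof.
move=> j0; rewrite /int_beta (negPf j0) root_formDr // root_formZr // root_formC //.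
rewrite !root_form_simple null_root_pairing0 simple_root_pairing (A0j j0).1; ring.
Qed.

Lemma int_beta_form i j : i != ord0 -> j != ord0 ->
  Q (int_beta i) (int_beta j) = A (lift ord0 i) (lift ord0 j) * D (lift ord0 j).
Proof.
move=> i0 j0; rewrite /int_beta (negPf i0) (negPf j0).
rewrite !(root_formDl, root_formZl) !(root_formDr AD, root_formZr AD).
rewrite null_root_isotropic (root_formC AD _ delta) !null_root_form root_form_simple.
by rewrite simple_root_pairing !mulr0 !add0r.
Qed.

Lemma int_beta_norm j : Q (int_beta j) (int_beta j) = 2 * D (lift ord0 j).
Proof.
have [A2 _ _] := A_gcm; have [->|j0] := eqVneq j ord0; last by rewrite int_beta_form // A2.
by rewrite int_beta_ord0 root_form_simple simple_root_pairing A2 D_affine.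
Qed.

Lemma border_shift j : j != ord0 -> border m j = - shift j.
Proof. by rewrite /border /shift -val_eqE /= => /negPf ->; case: eqP; rewrite ?oppr0. Qed.

(** The null root is added to a simple root of the same norm as [alpha_{-1}],
    which makes the first row and column of [C] agree. *)
Lemma shift_D j : shift j * D (lift ord0 j) = shift j * D ord0.
Proof.
rewrite /shift; case: eqP => j1; last by rewrite !mul0r.
by have [->|/D1 ->] := posnP m; rewrite ?mul0r.
Qed.

Lemma beta_matrixP i j : beta_matrix i j * Q (int_beta j) (int_beta j)
  = 2 * Q (int_beta i) (int_beta j).
Proof.
rewrite int_beta_norm mxE; have [->|i0] := eqVneq i ord0; have [->|j0] := eqVneq j ord0.
- by rewrite int_beta_norm.
- rewrite int_beta_ord0 int_beta_form0 // border_shift //.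
  by rewrite !mulNr mulrCA shift_D mulrN.
- rewrite (root_formC AD) int_beta_ord0 int_beta_form0 // border_shift // D_affine; ring.
- by rewrite int_beta_form // mulrCA.
Qed.

Lemma beta_matrix_gcm : gcm beta_matrix.
Proof.
have [A2 A_le0 A0] := A_gcm.
have border_le0 (j : 'I_r.+1) : j != ord0 -> border m j <= 0.
  by move=> j0; rewrite border_shift // oppr_le0 /shift; case: ifP.
split=> [i|i j ij|i j].
- by rewrite mxE A2; case: eqP => // ->.
- rewrite mxE; have [i0|i0] := eqVneq i ord0; first by rewrite border_le0 // -i0 eq_sym.
  by have [j0|j0] := eqVneq j ord0; [exact: border_le0|rewrite A_le0 // (inj_eq lift_inj)].
- rewrite !mxE; have [->|i0] := eqVneq i ord0; first by have [->|] := eqVneq j ord0.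
  by have [//|j0] := eqVneq j ord0; exact: A0.
Qed.

Lemma int_beta_nonneg j : nonneg (int_beta j).
Proof.
have [marks_gt0 _ _] := marks_null.
rewrite /int_beta; case: eqP => _; first exact: nonneg_simple_root.
apply: nonnegD; last exact: nonneg_simple_root.
move=> k; rewrite mxE mulr_ge0 //; first by rewrite /shift; case: ifP.
case: (unliftP ord0 k) => [l ->|->]; last by rewrite null_root0.
by rewrite null_rootS ltW.
Qed.

Lemma int_beta0 j : j != ord0 -> (int_beta j) 0 ord0 = 0.
Proof.
move=> /negPf j0; rewrite /int_beta j0 mxE mxE null_root0 mulr0 add0r simple_rootE.
by rewrite eq_sym (negPf (neq_lift _ _)).
Qed.

Lemma int_betaS j k : j != ord0 ->
  (int_beta j) 0 (lift ord0 k) = shift j * marks 0 k + (j == k)%:R.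
Proof.
move=> /negPf j0; rewrite /int_beta j0 mxE mxE null_rootS simple_rootE.
by rewrite (inj_eq lift_inj).
Qed.

(** Let [gamma = m delta + alpha_1 - alpha_j]. The coefficients of [gamma] at
    [alpha_0] and [alpha_1] are [m] and [m n_1 + 1], and both simple roots have
    norm 2, so an integral coroot would have [(gamma, gamma)] divide 2. But
    [(gamma, gamma) = 2 + (alpha_j, alpha_j) - 2 (alpha_1, alpha_j)] exceeds 2. *)
Lemma int_beta_sub_not_integral i j : i != j -> i != ord0 -> j != ord0 ->
  shift i = m%:Z -> shift j = 0 -> (0 < m)%N -> i = 1%N :> nat ->
  let gamma := int_beta i - int_beta j in
  [/\ nonneg gamma, 0 < Q gamma gamma & ~ integral_coroot A D gamma].
Proof.
move=> ij i0 j0 si sj m0 i1 gamma.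
have [A2 A_le0 _] := A_gcm; have [marks_gt0 _ marks0] := marks_null.
have EQ : Q gamma gamma = 2 * D ord0 + 2 * D (lift ord0 j)
                          - 2 * (A (lift ord0 i) (lift ord0 j) * D (lift ord0 j)).
  rewrite /gamma !(root_formDl, root_formNl) !(root_formDr AD, root_formNr AD).
  rewrite (root_formC AD (int_beta j) (int_beta i)) !int_beta_norm int_beta_form // (D1 m0 i1); ring.
have Qgt : 2 * D ord0 < Q gamma gamma.
  have := D_gt0 (lift ord0 j); have := A_le0 (lift ord0 i) (lift ord0 j).
  rewrite (inj_eq lift_inj) => /(_ ij); rewrite EQ.
  by move: (A _ _) (D (lift ord0 j)) (D ord0) => a b d; nia.
have gammaS k : gamma 0 (lift ord0 k) = m%:Z * marks 0 k + (i == k)%:R - (j == k)%:R.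
  by rewrite mxE mxE !int_betaS // si sj mul0r add0r.
split.
- move=> k; case: (unliftP ord0 k) => [l ->|->]; last by rewrite mxE mxE !int_beta0 // subrr.
  rewrite gammaS; have := marks_gt0 l; move: (marks 0 l) => a.
  by case: (i == l); case: (j == l) => /=; nia.
- by apply: lt_trans Qgt; rewrite mulr_gt0.
- move=> int_gamma; have := int_gamma (lift ord0 ord0); have := int_gamma (lift ord0 i).
  rewrite !gammaS marks0 D_affine (D1 m0 i1) eqxx (negPf i0) (negPf j0) eq_sym (negPf ij).
  move=> dvd1 dvd0.
  have : (Q gamma gamma %| (2 * D ord0)%R)%Z.
    have -> : 2 * D ord0 = 2 * (m%:Z * marks 0 i + 1 - 0) * D ord0
                         - marks 0 i * (2 * (m%:Z * 1 + 0 - 0) * D ord0) by ring.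
    by rewrite rpredB // dvdz_mull.
  have := D_gt0 ord0; move: Qgt; move: (D ord0) (Q _ _) => d q lt d0.
  rewrite dvdzE => /dvdn_leq; lia.
Qed.

End OverExtended.

(** * Cartan matrices *)

(** An indecomposable matrix has a connected diagram. *)
Lemma indecomposable_ind n (A : 'M[int]_n) (P : 'I_n -> Prop) i0 :
  indecomposable A -> P i0 -> (forall i j, P i -> A i j != 0 -> P j) -> forall j, P j.
Proof.
move=> indec P0 step j; pose e := [rel i j | A i j != 0].
suff /connectP[s s_path ->] : connect e i0 j.
  elim: s i0 P0 s_path => //= k s IH i Pi /andP[ik]; apply: IH; exact: step ik.
pose S := [set k | connect e i0 k].
suff /setP/(_ j) : S = setT by rewrite !inE.
apply/eqP/contraT => ST; have S0 : S != set0.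
  by apply/set0Pn; exists i0; rewrite inE connect0.
have [k [l [kS lS kl]]] := indec S S0 ST.
by move: lS; rewrite !inE in kS *; rewrite (connect_trans kS) // connect1.
Qed.

Lemma finite_type_unitmx n (B : 'M[int]_n) : finite_type B -> ratmx B \in unitmx.
Proof. by case=> _ _ rk _ _; rewrite -row_free_unit /row_free rk. Qed.

Lemma ratmx_inj_int n (A : 'M[int]_n) :
  (forall v : 'rV[rat]_n, v *m ratmx A = 0 -> v = 0) ->
  forall lam : 'rV[int]_n, lam *m A = 0 -> lam = 0.
Proof.
move=> inj lam lamA; have : map_mx intr lam = 0 :> 'rV[rat]_n.
  by apply: inj; rewrite -map_mxM lamA map_mx0.
move=> E; apply/rowP => j; move/rowP/(_ j): E; rewrite !mxE => /eqP.
by rewrite intr_eq0 => /eqP.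
Qed.

(** If [v A = 0], the affine part of [v] is mapped by the affine matrix to a
    multiple of a unit vector, so to zero by affine type: [v] vanishes at
    [alpha_{-1}]. The column of [alpha_{-1}] then shows that [v] vanishes at
    [alpha_0], and the finite matrix is invertible. *)
Lemma over_extended_inj r (A : 'M[int]_r.+2) : over_extended A ->
  forall lam : 'rV[int]_r.+2, lam *m A = 0 -> lam = 0.
Proof.
move=> [[A2 _ _] [_ _ _ _ aff] fin [A01 A10] A0j]; apply: ratmx_inj_int => v vA.
pose w : 'rV[rat]_r.+1 := \row_j v 0 (lift ord0 j).
have colS j : (w *m ratmx (drop_first A)) 0 j = - v 0 ord0 * (A ord0 (lift ord0 j))%:~R.
  move/rowP/(_ (lift ord0 j)): vA; rewrite !mxE big_ord_recl !mxE => /eqP.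
  rewrite addrC addr_eq0 mulNr => /eqP <-; apply: eq_bigr => i _; by rewrite !mxE.
have col_ge0 (c : rat) : 0 <= c * v 0 ord0 -> nneg_row (c *: w *m ratmx (drop_first A)).
  move=> cv j; rewrite -scalemxAl mxE colS; have [->|/A0j[-> _]] := eqVneq j ord0.
    by rewrite A01 mulrN1 opprK.
  by rewrite mulr0 mulr0.
have v0 : v 0 ord0 = 0.
  have aux (c : rat) : c != 0 -> 0 <= c * v 0 ord0 -> v 0 ord0 = 0.
    move=> c0 /col_ge0/aff; rewrite -scalemxAl => /rowP/(_ ord0)/eqP.
    rewrite mxE colS A01 mulrN1 opprK [X in _ == X]mxE mulf_eq0 (negPf c0) => /eqP; exact.
  have [v_ge0|v_lt0] := leP 0 (v 0 ord0); first by apply: (aux 1); rewrite ?mul1r ?oner_eq0.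
  by apply: (aux (-1)); rewrite ?oppr_eq0 ?oner_eq0 // mulN1r oppr_ge0 ltW.
have w0 : w 0 ord0 = 0.
  move/rowP/(_ ord0): vA; rewrite !mxE big_ord_recl v0 mul0r add0r big_ord_recl big1 => [|i _].
    by rewrite addr0 !mxE A10 mulrN1 => /eqP; rewrite oppr_eq0 => /eqP.
  by rewrite mxE; have [|_ ->] := A0j (lift ord0 i); rewrite ?mulr0 // eq_sym neq_lift.
pose u : 'rV[rat]_r := \row_j w 0 (lift ord0 j).
have u0 : u = 0.
  rewrite -[u](mulmxK (finite_type_unitmx fin)); suff -> : u *m ratmx (drop_first (drop_first A)) = 0.
    by rewrite mul0mx.
  apply/rowP => j; have E := colS (lift ord0 j).
  rewrite v0 oppr0 mul0r mxE big_ord_recl w0 mul0r add0r in E.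
  by rewrite [RHS]mxE -[RHS]E mxE; apply: eq_bigr => i _; rewrite !mxE.
apply/rowP => j; rewrite [RHS]mxE; case: (unliftP ord0 j) => [k ->|->//].
have -> : v 0 (lift ord0 k) = w 0 k by rewrite mxE.
case: (unliftP ord0 k) => [l ->|->//].
by have /rowP/(_ l) := u0; rewrite !mxE.
Qed.

Section Border.
Variables (r : nat) (r_gt0 : (0 < r)%N) (m : nat) (C : 'M[int]_r.+1).
Hypotheses (C_gcm : gcm C) (m_gt1 : (2 <= m)%N) (exceptional : ~ (r = 1%N /\ m = 2%N)).
Hypothesis C_border : forall j, C ord0 j = border m j /\ C j ord0 = border m j.
Hypothesis C_fin : finite_type (drop_first C).

Let i1 : 'I_r := Ordinal r_gt0.
Let B := ratmx (drop_first C).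

Let borderS (k : 'I_r) : border m (lift ord0 k) = - m%:Z * (k == i1)%:R.
Proof.
rewrite /border /= /bump /= add1n eqSS -val_eqE /=.
by case: eqP; rewrite ?mulr1 ?mulr0.
Qed.

Let tail (v : 'rV[rat]_r.+1) : 'rV[rat]_r := \row_k v 0 (lift ord0 k).

Let col0 (v : 'rV[rat]_r.+1) : (v *m ratmx C) 0 ord0 = 2 * v 0 ord0 - m%:R * tail v 0 i1.
Proof.
rewrite mxE big_ord_recl mxE (C_border ord0).1 mulrC; congr (_ + _).
rewrite (bigD1 i1) //= big1 => [|k /negPf ki].
  by rewrite !mxE (C_border _).2 borderS eqxx mulr1 addr0 mulrC rmorphN mulNr.
by rewrite mxE (C_border _).2 borderS ki mulr0 mulr0.
Qed.

Let colS (v : 'rV[rat]_r.+1) k : (v *m ratmx C) 0 (lift ord0 k)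
  = (tail v *m B) 0 k - m%:R * v 0 ord0 * (k == i1)%:R.
Proof.
rewrite mxE big_ord_recl mxE (C_border _).1 borderS addrC [in RHS]mxE; congr (_ + _).
  by apply: eq_bigr => i _; rewrite !mxE.
case: (k == i1); rewrite /= ?mulr1 ?mulr0 ?oppr0 //.
by rewrite rmorphN mulrN mulrC.
Qed.

(** The row of [alpha_1] in the inverse of the finite Cartan matrix. *)
Let u : 'rV[rat]_r := delta_mx 0 i1 *m invmx B.

Let uB : u *m B = delta_mx 0 i1.
Proof. by rewrite /u mulmxKV // finite_type_unitmx. Qed.

Let u_pos : pos_row u.
Proof.
have [_ _ _ _ H] := C_fin.
case: (H u) => // [j|u0]; first by rewrite uB mxE ler0n.
by move: uB => /rowP/(_ i1); rewrite u0 mul0mx !mxE !eqxx.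
Qed.

(** The equation [(u B)_1 = 1] reads [2 u_1 = 1 + s] with [s >= 0], and [s > 0] as
    soon as [alpha_1] has a neighbour. In the exceptional case [r = 1], [m = 2],
    where [C] is the affine matrix of rank one, both sides are equal. *)
Let u_bound : 2 < m%:R ^+ 2 * u 0 i1.
Proof.
have [[B2 B_le0 _] indec _ _ _] := C_fin.
have term_le0 k : k != i1 -> u 0 k * B k i1 <= 0.
  by move=> k1; rewrite pmulr_rle0 ?u_pos // [B k i1]mxE lerz0 B_le0.
have Eu : 2 * u 0 i1 = 1 - \sum_(k | k != i1) u 0 k * B k i1.
  have E1 : (u *m B) 0 i1 = 1 by rewrite uB mxE !eqxx.
  by rewrite -[X in X - _]E1 [X in X - _]mxE (bigD1 i1) //= addrK [B i1 i1]mxE B2 mulrC.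
have sum_le0 : \sum_(k | k != i1) u 0 k * B k i1 <= 0 by apply: sumr_le0.
have m2 : 2 <= m%:R :> rat by rewrite ler_nat.
have [m3|m_le2] := leqP 3 m.
  have {}m3 : 3 <= m%:R :> rat by rewrite ler_nat.
  have a_ge : 1 / 2 <= u 0 i1 by lra.
  have M_ge : 9 <= m%:R ^+ 2 :> rat by nra.
  by apply: lt_le_trans (ler_pM _ _ M_ge a_ge); lra.
have r1 : r != 1%N by apply/eqP => r1; apply: exceptional; split=> //; lia.
suff sum_lt0 : \sum_(k | k != i1) u 0 k * B k i1 < 0.
  have a_gt : 1 / 2 < u 0 i1 by lra.
  have M_ge : 4 <= m%:R ^+ 2 :> rat by nra.
  by apply: lt_le_trans (ler_wpM2r _ M_ge); lra.
have [||k [l []]] := indec [set~ i1].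
- have r2 : (1 < r)%N by lia.
  by apply/set0Pn; exists (Ordinal r2); rewrite !inE.
- by apply/eqP => /setP/(_ i1); rewrite !inE eqxx.
rewrite !inE negbK => k1 /eqP -> kB.
rewrite (bigD1 k) //=; apply: ltr_wnDr.
  by apply: sumr_le0 => j /andP[j1 _]; exact: term_le0.
by rewrite pmulr_rlt0 ?u_pos // [B k i1]mxE ltrz0 lt_neqAle kB B_le0.
Qed.

(** A kernel vector [(v_0, w)] satisfies [w = m v_0 u] and [2 v_0 = m w_1], whence
    [2 v_0 = m^2 u_1 v_0]. *)
Let C_unit : ratmx C \in unitmx.
Proof.
rewrite unitmxE unitfE; apply/negP => /det0P[v v0 vC].
have E0 := col0 v; rewrite vC mxE in E0.
have Ew : tail v = (m%:R * v 0 ord0) *: u.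
  rewrite -[tail v](mulmxK (finite_type_unitmx C_fin)) /u scalemxAl; congr (_ *m _).
  apply/rowP => k; have := colS v k; rewrite vC mxE => /esym/eqP.
  by rewrite subr_eq0 => /eqP ->; rewrite !mxE eqxx.
have v00 : v 0 ord0 = 0.
  move: E0; rewrite Ew mxE => E0; apply/eqP/contraT => vn0.
  have : v 0 ord0 * (2 - m%:R ^+ 2 * u 0 i1) = 0 by rewrite E0; ring.
  move/eqP; rewrite mulf_eq0 (negPf vn0) /= subr_eq0 => /eqP E2.
  by move: u_bound; rewrite -E2 ltxx.
case/eqP: v0; apply/rowP => j; rewrite [RHS]mxE; case: (unliftP ord0 j) => [k ->|->//].
have : tail v 0 k = 0 by rewrite Ew v00 mulr0 scale0r mxE.
by rewrite mxE.
Qed.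

Lemma bordered_rank : \rank (ratmx C) = r.+1.
Proof. exact: mxrank_unit C_unit. Qed.

Let m_neq0 : m%:R != 0 :> rat.
Proof. by rewrite pnatr_eq0; lia. Qed.

(** The vector [- (1/m, u)] has negative entries although its image under [C] is
    nonnegative: that image is [m u_1 - 2/m] at the first place and 0 elsewhere. *)
Lemma bordered_not_finite : ~ finite_type C.
Proof.
move=> [_ _ _ _ H].
pose v : 'rV[rat]_r.+1 := \row_j if unlift ord0 j is Some k then - u 0 k else - m%:R^-1.
have v0 : v 0 ord0 = - m%:R^-1 by rewrite mxE unlift_none.
have tv : tail v = - u by apply/rowP => k; rewrite [RHS]mxE [LHS]mxE [LHS]mxE liftK.
have m_gt0 : 0 < m%:R :> rat by rewrite ltr0n; lia.
case: (H v) => [j|/(_ ord0)|/rowP/(_ ord0)].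
- case: (unliftP ord0 j) => [k ->|->].
    rewrite colS tv v0 mulNmx uB !mxE eqxx /= mulrN divff // mulN1r opprK.
    by rewrite addNr.
  rewrite col0 tv v0 mxE mulrN mulrN opprK addrC subr_ge0 ler_pdivrMr //.
  by have := u_bound; rewrite expr2 => /ltW; rewrite mulrAC.
- by rewrite v0 oppr_gt0 ltNge invr_ge0 ltW.
- by rewrite v0 mxE => /eqP; rewrite oppr_eq0 invr_eq0 (negPf m_neq0).
Qed.

Lemma bordered_indecomposable : indecomposable C.
Proof.
have [_ indec _ _ _] := C_fin; move=> S S0 ST.
have m0 : - m%:Z != 0 by rewrite oppr_eq0; lia.
pose S' := [set k | lift ord0 k \in S].
have [S'0|S'0] := eqVneq S' set0.
  exists ord0, (lift ord0 i1); split.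
  - have /set0Pn[j jS] := S0; case: (unliftP ord0 j) jS => [k ->|-> //] kS.
    by have /setP/(_ k) := S'0; rewrite !inE kS.
  - by have /setP/(_ i1) := S'0; rewrite !inE => ->.
  - by rewrite (C_border _).1 borderS eqxx mulr1.
have [S'T|S'T] := eqVneq S' setT.
  exists (lift ord0 i1), ord0; split.
  - by have /setP/(_ i1) := S'T; rewrite !inE.
  - apply: contraNN ST => S_0; apply/eqP/setP => j; rewrite inE.
    case: (unliftP ord0 j) => [k ->|->//].
    by have /setP/(_ k) := S'T; rewrite !inE.
  - by rewrite (C_border _).2 borderS eqxx mulr1.
have [k [l [kS lS kl]]] := indec S' S'0 S'T.
exists (lift ord0 k), (lift ord0 l); rewrite !inE in kS lS; split=> //.
by move: kl; rewrite !mxE.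
Qed.

Lemma bordered_indefinite : indefinite_type C.
Proof.
split=> //; [exact: bordered_indecomposable|exact: bordered_not_finite|].
by case=> _ _ + _ _; rewrite bordered_rank => /eqP; rewrite eqn_leq ltnn.
Qed.

End Border.

(** * From the invariant form to an integral symmetrizer *)

Section SymmetricForm.
Variables (K : fieldType) (charK : [pchar K] =i pred0).

Lemma intr_char0_inj (k l : int) : (k%:~R : K) = l%:~R -> k = l.
Proof.
move=> E; apply/eqP; rewrite -subr_eq0; apply: contraT => /(intr_char0_neq0 charK).
by rewrite rmorphB /= E subrr eqxx.
Qed.

Variables (n : nat) (A : 'M[int]_n) (form : {symmetric 'rV[K]_n}).
Hypotheses (A_gcm : gcm A) (form_invariant : invariant_form A form).
Local Notation al := (@alpha K n).

Lemma form_sym u v : form u v = form v u.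
Proof. by rewrite hermC expr0 mul1r. Qed.

Lemma formZr a u v : form u (a *: v) = a * form u v.
Proof. exact: linearZr_LR. Qed.

Lemma form_sumr (I : Type) (s : seq I) (G : I -> 'rV[K]_n) u :
  form u (\sum_(i <- s) G i) = \sum_(i <- s) form u (G i).
Proof. exact: linear_sumr. Qed.

Lemma form_invariantE i j : (A i j)%:~R = 2 / form (al j) (al j) * form (al i) (al j).
Proof. by rewrite -form_invariant /coroot formZr. Qed.

Lemma form_norm_neq0 j : form (al j) (al j) != 0.
Proof.
have [A2 _ _] := A_gcm; have := form_invariantE j j; rewrite A2.
case: eqP => // ->; rewrite mulr0 => /eqP.
by rewrite (negPf (intr_char0_neq0 charK _)).
Qed.

Lemma form_simple i j : 2 * form (al i) (al j) = (A i j)%:~R * form (al j) (al j).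
Proof. by rewrite form_invariantE; field; exact: form_norm_neq0. Qed.

Lemma form_norm_sym i j :
  (A i j)%:~R * form (al j) (al j) = (A j i)%:~R * form (al i) (al i).
Proof. by rewrite -!form_simple form_sym. Qed.

(** The ratio of the norms of [alpha_i] and [alpha_j] is [A i j / A j i], which is
    positive because both entries are negative. *)
Lemma form_norm_step i j (a b : int) : A i j != 0 -> 0 < a -> 0 < b ->
  b%:~R * form (al i) (al i) = a%:~R ->
  exists a' b' : int, [/\ 0 < a', 0 < b' & b'%:~R * form (al j) (al j) = a'%:~R].
Proof.
have [A2 A_le0 A0] := A_gcm; have [<-|ij] := eqVneq i j; first by exists a, b.
move=> Aij a0 b0 Ea.
have Aji : A j i != 0 by apply: contraNneq Aij => /A0 ->.
exists (- A j i * a), (- A i j * b); split.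
- by rewrite mulr_gt0 // oppr_gt0 lt_neqAle Aji A_le0 // eq_sym.
- by rewrite mulr_gt0 // oppr_gt0 lt_neqAle Aij A_le0.
- by rewrite !rmorphM !rmorphN /= -Ea !mulNr mulrAC form_norm_sym; ring.
Qed.

Lemma common_denominator :
  (forall j, exists a b : int, [/\ 0 < a, 0 < b & b%:~R * form (al j) (al j) = a%:~R]) ->
  exists (N : int) (D : 'I_n -> int), [/\ 0 < N, forall j, 0 < D j
    & forall j, N%:~R * form (al j) (al j) = (D j)%:~R].
Proof.
move=> rat_norm.
have /fin_all_exists[ab Hab] j : exists ab : int * int,
    [/\ 0 < ab.1, 0 < ab.2 & ab.2%:~R * form (al j) (al j) = ab.1%:~R].
  by have [a [b]] := rat_norm j; exists (a, b).
exists (\prod_k (ab k).2), (fun j => (ab j).1 * \prod_(k | k != j) (ab k).2).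
split=> [|j|j]; first by apply: prodr_gt0 => k _; case: (Hab k).
  by case: (Hab j) => a0 _ _; rewrite mulr_gt0 //; apply: prodr_gt0 => k _; case: (Hab k).
have [_ _ E] := Hab j; rewrite (bigD1 j) //= !rmorphM /= -E; ring.
Qed.

Variables (N : int) (D : 'I_n -> int).
Hypothesis ND : forall j, N%:~R * form (al j) (al j) = (D j)%:~R.

Lemma symmetrizer i j : A i j * D j = A j i * D i.
Proof.
by apply: intr_char0_inj; rewrite !rmorphM /= -!ND mulrCA form_norm_sym mulrCA.
Qed.

Lemma form_root_form (lam mu : 'rV[int]_n) :
  (2 * N)%:~R * form (map_mx intr lam) (map_mx intr mu) = (root_form A D lam mu)%:~R.
Proof.
have rowE v : map_mx intr v = \sum_i (v 0 i)%:~R *: al i :> 'rV[K]_n.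
  by rewrite [LHS]row_sum_delta; apply: eq_bigr => i _; rewrite mxE.
rewrite (rowE mu) form_sumr mulr_sumr rmorph_sum; apply: eq_bigr => j _.
rewrite formZr form_sym (rowE lam) form_sumr mxE mulr_suml mulr_suml rmorph_sum.
rewrite !mulr_sumr; apply: eq_bigr => i _.
rewrite formZr form_sym !rmorphM /= -ND -mulrA.
transitivity (N%:~R * ((mu 0 j)%:~R * (lam 0 i)%:~R * (2 * form (al i) (al j)))); first by ring.
by rewrite form_simple; ring.
Qed.

End SymmetricForm.

(** * The subalgebra of the roots beta *)

Lemma betaE (K : fieldType) r (marks : 'rV[int]_r.+1) m j :
  beta K marks m j = map_mx intr (int_beta marks m j).
Proof.
have alE (i : 'I_r.+2) : alpha K i = map_mx intr (simple_root i).
  by apply/rowP => k; rewrite !mxE; case: (_ && _).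
have dE : null_root K marks = map_mx intr (int_null_root marks).
  apply/rowP => k; rewrite mxE !summxE rmorph_sum; apply: eq_bigr => i _.
  by rewrite /alpha_aff alE !mxE rmorphM.
rewrite /beta /int_beta -val_eqE /=; case: eqP => _; first exact: alE.
rewrite map_mxD -alE /shift; case: eqP => _; last by rewrite scale0r map_mx0 add0r.
by rewrite dE map_mxZ.
Qed.

Lemma root_space_int (K : fieldType) (L : lieAlgType K) n (A : 'M[int]_n) (h : 'I_n -> L)
    (lam : 'rV[int]_n) x :
  root_space A h (map_mx intr lam) x -> weight_space A h lam x.
Proof. by move=> H i; rewrite H /eval_h -map_mxM mxE scaler_int. Qed.

Section Main.
Variables (K : fieldType) (charK : [pchar K] =i pred0) (r : nat).
Variables (A : 'M[int]_r.+2) (A_over_extended : over_extended A).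
Variables (L : lieAlgType K) (e f h : 'I_r.+2 -> L).
Hypotheses (serre : serre_relations A e f h) (gen : forall x, subalg_gen e f h x).
Variables (marks : 'rV[int]_r.+1) (marks_null : null_root_marks A marks) (m : nat).
Variable D : 'I_r.+2 -> int.
Hypotheses (AD : forall i j, A i j * D j = A j i * D i) (D_gt0 : forall i, 0 < D i).
Hypothesis D1 : (0 < m)%N -> forall i : 'I_r.+1, i = 1%N :> nat -> D (lift ord0 i) = D ord0.
Local Notation wt := (weight_space A h).
Local Notation b := (int_beta marks m).

(** The difference of two of these roots has coordinates of both signs, except
    for [m delta + alpha_1] and a simple root of the finite part. *)
Lemma int_beta_sub_not_weight i j x : i != j -> wt (b i - b j) x -> x = 0.
Proof.
have [A_gcm _ _ [A01 A10] A0j] := A_over_extended.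
have A_inj := over_extended_inj A_over_extended.
have [A2 _ _] := A_gcm; have [marks_gt0 _ marks0] := marks_null.
have mixed lam k l y := @mixed_sign_not_weight _ charK _ _ _ _ _ _ serre gen A_inj lam k l y.
have b_pos k : k != ord0 -> 0 < (b k) 0 (lift ord0 k).
  move=> k0; rewrite int_betaS // eqxx ltr_wpDl ?ltr01 //; apply: mulr_ge0; last exact: ltW.
  by rewrite /shift; case: ifP.
have b0S k : (b ord0) 0 (lift ord0 k) = 0.
  by rewrite int_beta_ord0 simple_rootE (negPf (neq_lift _ _)).
have b00 : (b ord0) 0 ord0 = 1 by rewrite int_beta_ord0 simple_rootE eqxx.
move=> ij Hx; have [i0|i0] := eqVneq i ord0.
  have j0 : j != ord0 by rewrite eq_sym -i0.
  apply: (mixed _ ord0 (lift ord0 j) _ _ _ Hx); rewrite mxE mxE i0.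
    by rewrite b00 int_beta0 // subr0.
  by rewrite b0S sub0r oppr_lt0 b_pos.
have [j0|j0] := eqVneq j ord0.
  apply: (mixed _ (lift ord0 i) ord0 _ _ _ Hx); rewrite mxE mxE j0.
    by rewrite b0S subr0 b_pos.
  by rewrite b00 int_beta0.
have [shift_ij|shift_ij] := eqVneq (shift m i) (shift m j).
  apply: (mixed _ (lift ord0 i) (lift ord0 j) _ _ _ Hx); rewrite mxE mxE !int_betaS // shift_ij eqxx.
    by rewrite eq_sym (negPf ij); lia.
  by rewrite (negPf ij); lia.
have not_root k l : k != l -> k != ord0 -> l != ord0 -> k = 1%N :> nat ->
    shift m k != shift m l -> wt (b k - b l) x \/ wt (- (b k - b l)) x -> x = 0.
  move=> kl k0 l0 k1 s_kl.
  have sk : shift m k = m%:Z by rewrite /shift k1.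
  have sl : shift m l = 0.
    by rewrite /shift; case: eqP => // l1; case/eqP: kl; apply: val_inj; rewrite /= k1 l1.
  have m0 : (0 < m)%N by move: s_kl; rewrite sk sl; case: (m).
  have [ge0 pos nint] := int_beta_sub_not_integral A_gcm marks_null A01 A10 AD D_gt0 D1
    kl k0 l0 sk sl m0 k1.
  exact: (not_integral_not_weight charK serre gen A_inj A2 AD D_gt0 ge0 pos nint).
have [i1|i1] := eqVneq (i : nat) 1%N; first exact: (not_root i j ij i0 j0 i1 shift_ij (or_introl Hx)).
have [j1|j1] := eqVneq (j : nat) 1%N.
  by apply: (not_root j i _ j0 i0 j1); [rewrite eq_sym|rewrite eq_sym|right; rewrite opprB].
by move: shift_ij; rewrite /shift (negPf i1) (negPf j1).
Qed.

(** Adding a multiple of the null root does not change norms, so every [beta] has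
    positive norm and [real_root_coroot] applies to it. *)
Lemma beta_subalgebra (E F : 'I_r.+1 -> L) :
  (forall i, E i != 0 /\ wt (b i) (E i)) -> (forall i, F i != 0 /\ wt (- b i) (F i)) ->
  exists c : 'I_r.+1 -> K, (forall i, c i != 0) /\
    let F' := fun i => c i *: F i in
    serre_relations (beta_matrix A m) E F' (fun i => bracket (E i) (F' i)).
Proof.
have [A_gcm _ _ [A01 A10] A0j] := A_over_extended.
have A_inj := over_extended_inj A_over_extended.
have [A2 _ _] := A_gcm; move=> HE HF.
have b_norm i := int_beta_norm m A_gcm marks_null A01 A10 AD i.
have /fin_all_exists[c Hc] i : exists c : K,
    [/\ c != 0, ad_nilpotent (E i), ad_nilpotent (F i)
      & forall lam z (t : int), wt lam z ->
        t * root_form A D (b i) (b i) = 2 * root_form A D lam (b i) ->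
        bracket (bracket (E i) (c *: F i)) z = z *~ t].
  have [[E0 wE] [F0 wF]] := (HE i, HF i).
  apply: (real_root_coroot charK serre gen A_inj A2 AD D_gt0 _ _ wE wF E0 F0).
    exact: int_beta_nonneg marks_null i.
  by rewrite b_norm mulr_gt0.
exists c; split=> [i|F']; first by case: (Hc i).
have [C2 C_le0 _] := beta_matrix_gcm m A_gcm.
apply: (root_vectors_serre (A := A) (h := h) (D := D) charK (beta := b)) => //.
- by move=> i; case: (HE i).
- by move=> i; apply: weight_spaceZ; case: (HF i).
- by move=> i; case: (Hc i).
- by move=> i; apply: ad_nilpotentZ; case: (Hc i).
- move=> i j ij; apply: (int_beta_sub_not_weight ij); apply: weight_space_bracket.
    by case: (HE i).
  by apply: weight_spaceZ; case: (HF j).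
- by move=> i; case: (Hc i).
- exact: beta_matrixP.
Qed.

End Main.

Lemma subalg_gen_scale (K : fieldType) (L : lieAlgType K) n (E F : 'I_n -> L) (c : 'I_n -> K) x :
  (forall i, c i != 0) ->
  subalg_gen E F (fun i => bracket (E i) (F i)) x <->
  subalg_gen E (fun i => c i *: F i) (fun i => bracket (E i) (c i *: F i)) x.
Proof.
move=> c0.
have aux (a : 'I_n -> K) (F1 F2 : 'I_n -> L) y : (forall i, F2 i = a i *: F1 i) ->
    subalg_gen E F2 (fun i => bracket (E i) (F2 i)) y ->
    subalg_gen E F1 (fun i => bracket (E i) (F1 i)) y.
  move=> EF; apply: lie_span_sub => {}y [i [->|->|->]].
  - by apply: lie_span_gen; exists i; apply: Or31.
  - by rewrite EF; apply/lie_spanZ/lie_span_gen; exists i; apply: Or32.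
  - by rewrite EF bracketZr; apply/lie_spanZ/lie_span_gen; exists i; apply: Or33.
split; last exact: aux.
by apply: (aux (fun i => (c i)^-1)) => i; rewrite scalerA mulVf ?scale1r.
Qed.

Theorem theorem3p3
  (K : fieldType) (charK : [pchar K] =i pred0)
  (r : nat) (r_gt0 : (0 < r)%N)
  (A : 'M[int]_r.+2) (A_over_extended : over_extended A)
  (L : lieAlgType K) (e f h : 'I_r.+2 -> L)
  (L_kac_moody : kac_moody_algebra A e f h)
  (form : {symmetric 'rV[K]_r.+2}) (form_invariant : invariant_form A form)
  (norm_m1 : form (alpha_m1 K r) (alpha_m1 K r) = 2)
  (form_m1_0 : form (alpha_m1 K r) (alpha_aff K ord0) = -1)
  (form_m1_i : forall i : 'I_r.+1, i != ord0 ->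
     form (alpha_m1 K r) (alpha_aff K i) = 0)
  (marks : 'rV[int]_r.+1) (marks_null : null_root_marks A marks)
  (m : nat)
  (norm_1 : (0 < m)%N -> forall i : 'I_r.+1, i = 1%N :> nat ->
     form (alpha_aff K i) (alpha_aff K i) = 2) :
  exists C : 'M[int]_r.+1,
    [/\ forall i j, form (beta K marks m i) (coroot form (beta K marks m j))
                    = (C i j)%:~R,
        forall j, C ord0 j = border m j /\ C j ord0 = border m j,
        drop_first C = drop_first (drop_first A),
        forall E F : 'I_r.+1 -> L,
          (forall i, E i != 0 /\ root_space A h (beta K marks m i) (E i)) ->
          (forall i, F i != 0 /\ root_space A h (- beta K marks m i) (F i)) ->
          let S := subalg_gen E F (fun i => bracket (E i) (F i)) in
          exists c : 'I_r.+1 -> K,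
            (forall i, c i != 0) /\
            let F' := fun i => c i *: F i in
            kac_moody_subalg S C E F' (fun i => bracket (E i) (F' i))
      & (2 <= m)%N -> ~ (r = 1%N /\ m = 2%N) ->
          \rank (ratmx C) = r.+1 /\ indefinite_type C].
Proof.
have [A_gcm [_ aff_indec _ _ _] fin [A01 A10] A0j] := A_over_extended.
have [gen serre _] := L_kac_moody.
have rat_norm : forall j : 'I_r.+2, exists a b : int,
    [/\ 0 < a, 0 < b & b%:~R * form (alpha K j) (alpha K j) = a%:~R].
  have step i j := @form_norm_step _ charK _ _ _ A_gcm form_invariant i j.
  have norm0 : exists a b : int,
      [/\ 0 < a, 0 < b & b%:~R * form (alpha K ord0) (alpha K ord0) = a%:~R].
    by exists 2, 1; split=> //; rewrite mul1r -[RHS]norm_m1.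
  have norm_aff : forall j : 'I_r.+1, exists a b : int,
      [/\ 0 < a, 0 < b & b%:~R * form (alpha K (lift ord0 j)) (alpha K (lift ord0 j)) = a%:~R].
    apply: (indecomposable_ind (i0 := ord0) aff_indec).
      by have [a [b [a0 b0 Eab]]] := norm0; apply: (step ord0 _ a b) => //; rewrite A01.
    by move=> i j [a [b [a0 b0 Eab]]]; rewrite !mxE => Aij; apply: (step _ _ a b Aij).
  by move=> j; case: (unliftP ord0 j) => [k ->|->].
have [N [D [N0 D_gt0 ND]]] := common_denominator rat_norm.
have AD := symmetrizer charK A_gcm form_invariant ND.
have D1 : (0 < m)%N -> forall i : 'I_r.+1, i = 1%N :> nat -> D (lift ord0 i) = D ord0.
  move=> m0 i i1; apply: (intr_char0_inj charK); rewrite -!ND.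
  by congr (_ * _); rewrite -[LHS]/(form (alpha_aff K i) (alpha_aff K i)) norm_1.
have C_gcm := beta_matrix_gcm m A_gcm.
have C_border j : beta_matrix A m ord0 j = border m j /\ beta_matrix A m j ord0 = border m j.
  by rewrite !mxE eqxx; split=> //; case: eqP => // ->.
have C_fin : drop_first (beta_matrix A m) = drop_first (drop_first A).
  by apply/matrixP => i j; rewrite !mxE.
exists (beta_matrix A m); split=> //.
- move=> i j; rewrite /coroot formZr !betaE.
  have Q0 : root_form A D (int_beta marks m j) (int_beta marks m j) != 0.
    by rewrite (int_beta_norm m A_gcm marks_null A01 A10 AD) mulf_neq0 ?lt0r_neq0.
  have F2 := form_root_form charK A_gcm form_invariant ND.
  have N2 : (2 * N)%:~R != 0 :> K by apply: intr_char0_neq0; rewrite // mulf_neq0 ?lt0r_neq0.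
  have EC := beta_matrixP A_gcm marks_null A01 A10 A0j AD D1 i j.
  have := congr1 (fun k : int => k%:~R : K) EC; rewrite /= !rmorphM /= -!F2.
  move: (intr_char0_neq0 charK Q0); rewrite -F2 mulf_eq0 negb_or => /andP[_ Fn0].
  move=> EF; apply: (mulIf Fn0); apply: (mulfI N2).
  by rewrite [RHS]mulrCA EF; field.
- move=> E F HE HF S.
  have HE' i : E i != 0 /\ weight_space A h (int_beta marks m i) (E i).
    by have [E0 wE] := HE i; split=> //; apply: root_space_int; rewrite -betaE.
  have HF' i : F i != 0 /\ weight_space A h (- int_beta marks m i) (F i).
    by have [F0 wF] := HF i; split=> //; apply: root_space_int; rewrite map_mxN -betaE.
  have [c [c0 Hc]] :=
    beta_subalgebra charK A_over_extended serre gen marks_null AD D_gt0 D1 HE' HF'.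
  by exists c; split=> // F'; split=> // x; exact: subalg_gen_scale.
- move=> m2 exc; rewrite -C_fin in fin.
  split; first exact: (bordered_rank r_gt0 m2 exc C_border fin).
  exact: (bordered_indefinite r_gt0 C_gcm m2 exc C_border fin).
Qed.
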